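(* Let $\mathcal{T}_\circ$ be the family of Poncelet triangles inscribed in the non-circular ellipse $\mathcal{E}$ with semiaxes $a>b$ and circumscribing a circle $\mathcal{K}$ with center $C=[x_c,y_c]$. Over $\mathcal{T}_\circ$, the envelope of the circumcircle is the union of two nested circles, each tangent to $\mathcal{E}$ at two points, and centered at the foci $F_3$ and $F_3'$ of the locus $\mathcal{L}_3$ of the circumcenter $X_3$ over $\mathcal{T}_\circ$.
   Context: $\mathcal{E}$ is the ellipse $x^2/a^2+y^2/b^2=1$ with $a>b>0$. $\mathcal{K}$ is a circle with center $C=[x_c,y_c]$ contained in the interior of $\mathcal{E}$, whose radius is such that some triangle is inscribed in $\mathcal{E}$ and has its three sides tangent to $\mathcal{K}$; by Poncelet's porism every point of $\mathcal{E}$ is then a vertex of such a triangle, and $\mathcal{T}_\circ$ is the one-parameter family of all such triangles ($\mathcal{K}$ is their common incircle). $\mathcal{L}_3$, the locus of the circumcenters of the triangles in $\mathcal{T}_\circ$, is known to be a conic with foci $$F_3=\left[x_c\left(1-(b/a)^2\right),\,0\right],\qquad F_3'=\left[0,\,y_c\left(1-(a/b)^2\right)\right].$$ The envelope of a one-parameter family of circles $K(x,y;u)=0$ is the set of $(x,y)$ with $K=0$ and $\partial K/\partial u=0$ for some $u$. *)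

(* Defs.v *)
From Stdlib Require Import Reals.
From Coquelicot Require Import Coquelicot.
Open Scope R_scope.

Definition point : Type := (R * R)%type.

Definition pdist (P Q : point) : R := dist_euc (fst P) (snd P) (fst Q) (snd Q).

Definition on_ellipse (a b : R) (P : point) : Prop :=
  (fst P)^2 / a^2 + (snd P)^2 / b^2 = 1.

Definition inside_ellipse (a b : R) (P : point) : Prop :=
  (fst P)^2 / a^2 + (snd P)^2 / b^2 < 1.

Definition on_circle (c : point) (rho : R) (P : point) : Prop := pdist P c = rho.

Record plane_triangle : Type := Triangle { vA : point; vB : point; vC : point }.

Definition nondegenerate (t : plane_triangle) : Prop :=
  (fst (vB t) - fst (vA t)) * (snd (vC t) - snd (vA t))
  - (snd (vB t) - snd (vA t)) * (fst (vC t) - fst (vA t)) <> 0.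

Definition is_vertex (t : plane_triangle) (P : point) : Prop :=
  P = vA t \/ P = vB t \/ P = vC t.

(* Equality of unlabelled triangles. *)
Definition same_triangle (t t' : plane_triangle) : Prop :=
  forall P, is_vertex t P <-> is_vertex t' P.

(* The closed segment [P,Q], and not merely the line PQ, touches the circle:
   a circle touching the three sides of a triangle in this sense is its
   incircle, never an excircle. *)
Definition side_tangent (c : point) (rho : R) (P Q : point) : Prop :=
  exists s : R, 0 <= s <= 1 /\
    let M := (fst P + s * (fst Q - fst P), snd P + s * (snd Q - snd P)) in
    on_circle c rho M /\
    (fst M - fst c) * (fst Q - fst P) + (snd M - snd c) * (snd Q - snd P) = 0.

Definition poncelet_triangle (a b : R) (c : point) (r : R) (t : plane_triangle) : Prop :=
  nondegenerate t /\
  (forall P, is_vertex t P -> on_ellipse a b P) /\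
  side_tangent c r (vA t) (vB t) /\
  side_tangent c r (vB t) (vC t) /\
  side_tangent c r (vC t) (vA t).

Definition regular_curve (g : R -> point) : Prop :=
  forall u, exists v : R * R, v <> (0, 0) /\
    is_derive (fun w => fst (g w)) u (fst v) /\
    is_derive (fun w => snd (g w)) u (snd v).

(* Each triangle of the family occurs, possibly more than once and with any
   labelling of its vertices.  Nonvanishing velocity cannot be dropped: where a
   parametrization is stationary, the condition dK/du = 0 in the envelope
   becomes vacuous. *)
Definition regular_parametrization (F : plane_triangle -> Prop) (T : R -> plane_triangle) : Prop :=
  (forall u, F (T u)) /\
  (forall t, F t -> exists u, same_triangle (T u) t) /\
  regular_curve (fun u => vA (T u)) /\
  regular_curve (fun u => vB (T u)) /\
  regular_curve (fun u => vC (T u)).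

Definition is_circumcircle (t : plane_triangle) (o : point) (rho : R) : Prop :=
  forall P, is_vertex t P -> on_circle o rho P.

Definition circumcenter_locus (F : plane_triangle -> Prop) (X : point) : Prop :=
  exists t rho, F t /\ is_circumcircle t X rho.

(* K(P;u) for the family of circles with centers o u and radii rho u. *)
Definition circle_eqn (o : R -> point) (rho : R -> R) (P : point) (u : R) : R :=
  (fst P - fst (o u))^2 + (snd P - snd (o u))^2 - (rho u)^2.

Definition envelope (K : point -> R -> R) (P : point) : Prop :=
  exists u, K P u = 0 /\ is_derive (fun w => K P w) u 0.

(* Nondegenerate ellipse or hyperbola, by the focal definition; F = F' gives a
   circle. *)
Definition conic_with_foci (S : point -> Prop) (F F' : point) : Prop :=
  exists s : R,
    (pdist F F' < s /\ forall P, S P <-> pdist P F + pdist P F' = s) \/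
    (0 < s < pdist F F' /\ forall P, S P <-> Rabs (pdist P F - pdist P F') = s).

(* Common point at which the normal vectors (gradients of the two equations)
   are parallel. *)
Definition tangent_to_ellipse_at (a b : R) (c : point) (rho : R) (P : point) : Prop :=
  on_circle c rho P /\ on_ellipse a b P /\
  (fst P - fst c) * (snd P / b^2) - (snd P - snd c) * (fst P / a^2) = 0.

Definition tangent_to_ellipse_at_two_points (a b : R) (c : point) (rho : R) : Prop :=
  exists P Q : point, P <> Q /\
    forall M, tangent_to_ellipse_at a b c rho M <-> M = P \/ M = Q.

Definition inside_circle (c : point) (rho : R) (P : point) : Prop := pdist P c < rho.

Definition nested_circles (c : point) (rho : R) (c' : point) (rho' : R) : Prop :=
  (forall P, pdist P c <= rho -> inside_circle c' rho' P) \/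
  (forall P, pdist P c' <= rho' -> inside_circle c rho P).

(* Main.v *)
Require Import Defs.
From Stdlib Require Import Reals Lra.
From Coquelicot Require Import Coquelicot.
Open Scope R_scope.

(** Scale the plane so that the ellipse becomes the unit circle of the complex plane,
and the circle K becomes an ellipse with foci f, g.  A chord joining z1 and z2 on the
unit circle touches the scaled K exactly when a polynomial in z1 + z2 and z1 * z2
vanishes ([chord_tangent]).  Eliminating between the three sides of a Poncelet triangle
shows that its vertices are the solutions of B(z) = l, where l is their product and
B(z) = z (z - f) (z - g) / ((1 - conj f z) (1 - conj g z)) is a Blaschke product of
degree three, and that the data satisfy one scalar closure relation
([tangent_triangle_relations]).  Conversely the closure relation makes every l on
the unit circle occur: one solution of B(z) = l comes from the intermediate value
theorem, and the chord through the other two touches the scaled K, hence passes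
through the open disc, which puts these two on the unit circle
([poncelet_triangle_exists]).  So the family of triangles is parametrized by l.

By Vieta, z1 + z2 + z3 is affine in l.  Four concyclic points of the ellipse have
eccentric angles adding up to zero, so the circumcircle meets the ellipse once more at
1/l, and the coefficients of the quartic with roots z1, z2, z3, 1/l show that the
equation of the circumcircle is affine in l as well:
K(P) = A(P) + B(P) Re l + E(P) Im l ([poncelet_circumcircle], [circle_family_affine]).
The circumcenter is thus an affine image of a point of the unit circle, and computing
the Gram matrix of this affine map identifies its locus as an ellipse with the two
required foci ([circumcenter_locus_conic]).

For a regular parametrization, l moves with nonzero velocity: if l stopped, so would
the elementary symmetric functions of the vertices, hence the vertices
([vertex_product_velocity]).  The envelope is therefore the curve
A^2 = B^2 + E^2 ([envelope_discriminant]), and the closure relation is exactly what makes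
A^2 - B^2 - E^2 split into the equations of two circles ([discriminant_factors]).
Each of these equations is a combination of the equation of the ellipse and the square
of the equation of a line parallel to an axis through the center of K
([inner_equation_defect], [outer_equation_defect]); double contact with the ellipse and
nesting follow from this. *)

Local Open Scope C_scope.

(** * Complex numbers of modulus one *)

Lemma Cmult_eq0 (x y : C) : x * y = 0 -> x <> 0 -> y = 0.
Proof.
  intros H Hx; replace y with (/ x * (x * y)) by (field; exact Hx).
  rewrite H; ring.
Qed.

Lemma neq_sym {T : Type} (x y : T) : x <> y -> y <> x.
Proof. intros H E; apply H; symmetry; exact E. Qed.

Lemma Csub_eq0 (x y : C) : x - y = 0 -> x = y.
Proof. intros H; replace x with (x - y + y) by ring; rewrite H; ring. Qed.

(** The [linear_combination] lemmas reduce deducing an equation from others to checking an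
identity with explicit cofactors, which [ring] or [field] decides. *)
Lemma linear_combination1 (c x y u v : C) :
  x = y -> u - v = c * (x - y) -> u = v.
Proof. intros H E; apply Csub_eq0; rewrite E, H; ring. Qed.

Lemma linear_combination2 (c1 c2 x1 y1 x2 y2 u v : C) :
  x1 = y1 -> x2 = y2 -> u - v = c1 * (x1 - y1) + c2 * (x2 - y2) -> u = v.
Proof. intros H1 H2 E; apply Csub_eq0; rewrite E, H1, H2; ring. Qed.

Lemma linear_combination3 (c1 c2 c3 x1 y1 x2 y2 x3 y3 u v : C) :
  x1 = y1 -> x2 = y2 -> x3 = y3 ->
  u - v = c1 * (x1 - y1) + c2 * (x2 - y2) + c3 * (x3 - y3) -> u = v.
Proof. intros H1 H2 H3 E; apply Csub_eq0; rewrite E, H1, H2, H3; ring. Qed.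

Definition on_unit_circle (z : C) : Prop := z * Cconj z = 1.

Lemma on_unit_circle_neq0 (z : C) : on_unit_circle z -> z <> 0.
Proof.
  intros H Hz; unfold on_unit_circle in H; rewrite Hz, Cmult_0_l in H.
  apply (f_equal fst) in H; simpl in H; lra.
Qed.

Lemma on_unit_circle_conj (z : C) : on_unit_circle z -> Cconj z = / z.
Proof.
  intros H; assert (Hz := on_unit_circle_neq0 z H).
  apply Csub_eq0, (Cmult_eq0 z); [|exact Hz].
  unfold on_unit_circle in H.
  transitivity (z * Cconj z - z * / z); [ring | rewrite H, Cinv_r by exact Hz; ring].
Qed.

Lemma on_unit_circle_coord (z : C) :
  on_unit_circle z <-> (fst z * fst z + snd z * snd z = 1)%R.
Proof.
  destruct z as [x y]; unfold on_unit_circle, Cconj, Cmult, RtoC; simpl; split.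
  - intros H; apply (f_equal fst) in H; simpl in H; lra.
  - intros H; apply injective_projections; simpl; lra.
Qed.

Lemma on_unit_circle_mult (z z' : C) :
  on_unit_circle z -> on_unit_circle z' -> on_unit_circle (z * z').
Proof.
  unfold on_unit_circle; intros H H'; rewrite Cmult_conj.
  transitivity ((z * Cconj z) * (z' * Cconj z')); [ring | rewrite H, H'; ring].
Qed.

Lemma on_unit_circle_Cconj (z : C) : on_unit_circle z -> on_unit_circle (Cconj z).
Proof.
  unfold on_unit_circle; intros H; rewrite Cconj_conj, Cmult_comm; exact H.
Qed.

Lemma RtoC_conj (x : R) : Cconj x = x.
Proof. apply injective_projections; simpl; lra. Qed.

(** Real identities on the unit circle become rational identities in z once coordinates are
written with z and its conjugate 1/z. *)
Lemma coordinates_of_conj (z : C) :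
  RtoC (fst z) = (z + Cconj z) / 2 /\ RtoC (snd z) = - Ci * ((z - Cconj z) / 2).
Proof.
  split; apply injective_projections; simpl; field.
Qed.

Lemma Ci_square : Ci * Ci = - (1).
Proof. apply injective_projections; simpl; ring. Qed.

Lemma real_of_conj (x : C) : Cconj x = x -> x = RtoC (fst x).
Proof.
  intros H; apply (f_equal snd) in H; simpl in H.
  apply injective_projections; simpl; lra.
Qed.

(** Square roots play the role of half angles: the chord joining z1 and z2 is orthogonal to
a square root of z1 z2. *)
Lemma unit_sqrt (z : C) :
  on_unit_circle z -> exists rho, on_unit_circle rho /\ rho ^ 2 = z.
Proof.
  intros Hz.
  assert (Hc := proj1 (on_unit_circle_coord z) Hz).
  destruct z as [x y]; simpl in Hc.
  destruct (Req_dec x (-1)) as [->|Hx].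
  - exists (0, 1)%R; split.
    + apply on_unit_circle_coord; simpl; lra.
    + apply injective_projections; simpl; nra.
  - assert (Hx1 : (0 < (1 + x) / 2)%R) by nra.
    assert (Hs := sqrt_sqrt _ (Rlt_le _ _ Hx1)).
    assert (Hp := sqrt_lt_R0 _ Hx1).
    set (t := sqrt ((1 + x) / 2)) in *.
    assert (Hy : (y / (2 * t) * (y / (2 * t)) = (1 - x) / 2)%R).
    { replace (y / (2 * t) * (y / (2 * t)))%R with (y * y / (4 * (t * t)))%R by (field; lra).
      rewrite Hs; replace (y * y)%R with ((1 - x) * (1 + x))%R by lra; field; lra. }
    exists (t, y / (2 * t))%R; split.
    + apply on_unit_circle_coord; simpl; lra.
    + apply injective_projections; simpl.
      * rewrite ?Rmult_1_r, ?Rmult_0_r, ?Rmult_1_l; lra.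
      * field; lra.
Qed.

(** * Chords tangent to a scaled circle and the Blaschke equation *)

(** The chord of the unit circle with endpoints of sum s and product p lies on the line
Z + p conj Z = s.  The equation says that this line touches the ellipse with center w, axes
parallel to the coordinate axes and squared semiaxes (h - k) / 2 and (h + k) / 2; see
[tangency_normal_form]. *)
Definition chord_tangent (w : C) (k h : R) (s p : C) : Prop :=
  (w + p * Cconj w - s) ^ 2 + k * (1 + p ^ 2) - 2 * h * p = 0.

(** The equation B(z) = l for the Blaschke product of degree three with zeros 0 and the foci
f, g = w +- i sqrt k, cleared of denominators; here (z - f) (z - g) = (z - w)^2 + k. *)
Definition closing_point (w : C) (k : R) (l z : C) : Prop :=
  z * ((z - w) ^ 2 + k) = l * ((1 - Cconj w * z) ^ 2 + k * z ^ 2).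

(** This is f + g + l conj (f g), the sum of the three solutions of B(z) = l. *)
Definition vertex_sum (w : C) (k : R) (l : C) : C :=
  2 * w + l * (Cconj w ^ 2 + k).

(** The analogue for an ellipse of the Euler-Chapple relation R^2 - d^2 = 2 R r: the condition
for triangles inscribed in the unit circle to circumscribe the ellipse. *)
Definition closure_relation (w : C) (k h : R) : Prop :=
  2 * h = 1 - 2 * w * Cconj w + (w ^ 2 + k) * (Cconj w ^ 2 + k).

Lemma chord_tangent_sym (w z1 z2 : C) (k h : R) :
  chord_tangent w k h (z1 + z2) (z1 * z2) -> chord_tangent w k h (z2 + z1) (z2 * z1).
Proof. rewrite (Cplus_comm z2), (Cmult_comm z2); trivial. Qed.

(** For a fixed endpoint z, tangency is a quadratic equation in the other endpoint: these are
the two Vieta formulas for its roots, the other ends of the two tangents drawn from z. *)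
Lemma second_intersections (w : C) (k h : R) (z z2 z3 : C) :
  z2 <> z3 ->
  chord_tangent w k h (z + z2) (z * z2) ->
  chord_tangent w k h (z + z3) (z * z3) ->
  (z2 + z3) * ((1 - Cconj w * z) ^ 2 + k * z ^ 2)
    = 2 * h * z + 2 * (w - z) * (1 - Cconj w * z) /\
  z2 * z3 * ((1 - Cconj w * z) ^ 2 + k * z ^ 2) = (z - w) ^ 2 + k.
Proof.
  unfold chord_tangent; intros Hne H2 H3.
  assert (Hs : (z2 + z3) * ((1 - Cconj w * z) ^ 2 + k * z ^ 2)
    - (2 * h * z + 2 * (w - z) * (1 - Cconj w * z)) = 0).
  { apply (Cmult_eq0 (z2 - z3)); [|apply Cminus_eq_contra, Hne].
    apply (linear_combination2 1 (- (1)) _ _ _ _ _ _ H2 H3); ring. }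
  split; [apply Csub_eq0, Hs|].
  apply (linear_combination2 z2 (- (1)) _ _ _ _ _ _ Hs H2); ring.
Qed.

Lemma monic_cubic_root_sum (s q c z1 z2 z3 : C) :
  z1 <> z2 -> z1 <> z3 -> z2 <> z3 ->
  z1 ^ 3 - s * z1 ^ 2 + q * z1 - c = 0 ->
  z2 ^ 3 - s * z2 ^ 2 + q * z2 - c = 0 ->
  z3 ^ 3 - s * z3 ^ 2 + q * z3 - c = 0 ->
  z1 + z2 + z3 = s.
Proof.
  intros N12 N13 N23 H1 H2 H3.
  assert (H12 : z1 ^ 2 + z1 * z2 + z2 ^ 2 - s * (z1 + z2) + q = 0).
  { apply (Cmult_eq0 (z1 - z2)); [|apply Cminus_eq_contra, N12].
    apply (linear_combination2 1 (- (1)) _ _ _ _ _ _ H1 H2); ring. }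
  assert (H13 : z1 ^ 2 + z1 * z3 + z3 ^ 2 - s * (z1 + z3) + q = 0).
  { apply (Cmult_eq0 (z1 - z3)); [|apply Cminus_eq_contra, N13].
    apply (linear_combination2 1 (- (1)) _ _ _ _ _ _ H1 H3); ring. }
  apply Csub_eq0, (Cmult_eq0 (z2 - z3)); [|apply Cminus_eq_contra, N23].
  apply (linear_combination2 1 (- (1)) _ _ _ _ _ _ H12 H13); ring.
Qed.

Lemma closing_point_cubic (w : C) (k : R) (l z : C) :
  closing_point w k l z <->
  z ^ 3 - vertex_sum w k l * z ^ 2 + (w ^ 2 + k + 2 * l * Cconj w) * z - l = 0.
Proof.
  unfold closing_point, vertex_sum; split; intros H.
  - apply (linear_combination1 1 _ _ _ _ H); ring.
  - apply (linear_combination1 1 _ _ _ _ H); ring.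
Qed.

(** Multiplying the product formula of [second_intersections] by z shows that the product l
satisfies B(z) = l at each vertex.  The vertices are then the three roots of a monic cubic,
which gives their sum, and comparing with the sum formula of [second_intersections] leaves
the closure relation. *)
Lemma tangent_triangle_relations (w : C) (k h : R) (z1 z2 z3 : C) :
  z1 <> z2 -> z1 <> z3 -> z2 <> z3 -> z1 <> 0 ->
  chord_tangent w k h (z1 + z2) (z1 * z2) ->
  chord_tangent w k h (z1 + z3) (z1 * z3) ->
  chord_tangent w k h (z2 + z3) (z2 * z3) ->
  closing_point w k (z1 * z2 * z3) z1 /\
  z1 + z2 + z3 = vertex_sum w k (z1 * z2 * z3) /\
  closure_relation w k h.
Proof.
  intros N12 N13 N23 Nz T12 T13 T23.
  destruct (second_intersections w k h z1 z2 z3 N23 T12 T13) as [S1 P1].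
  assert (T21 : chord_tangent w k h (z2 + z1) (z2 * z1))
    by (rewrite (Cplus_comm z2), (Cmult_comm z2); exact T12).
  assert (T31 : chord_tangent w k h (z3 + z1) (z3 * z1))
    by (rewrite (Cplus_comm z3), (Cmult_comm z3); exact T13).
  assert (T32 : chord_tangent w k h (z3 + z2) (z3 * z2))
    by (rewrite (Cplus_comm z3), (Cmult_comm z3); exact T23).
  destruct (second_intersections w k h z2 z1 z3 N13 T21 T23) as [_ P2].
  destruct (second_intersections w k h z3 z1 z2 N12 T31 T32) as [_ P3].
  set (l := z1 * z2 * z3).
  assert (R1 : closing_point w k l z1)
    by (unfold closing_point, l; rewrite <- P1; ring).
  assert (R2 : closing_point w k l z2)
    by (unfold closing_point, l; rewrite <- P2; ring).
  assert (R3 : closing_point w k l z3)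
    by (unfold closing_point, l; rewrite <- P3; ring).
  assert (Hsum : z1 + z2 + z3 = vertex_sum w k l).
  { apply (monic_cubic_root_sum _ (w ^ 2 + k + 2 * l * Cconj w) l); try assumption;
      apply closing_point_cubic; assumption. }
  split; [exact R1 | split; [exact Hsum |]].
  unfold closure_relation; apply Csub_eq0, (Cmult_eq0 z1); [|exact Nz].
  (* Here z2 + z3 is replaced by vertex_sum - z1, which leaves an equation in z1 and l. *)
  assert (S1' : (vertex_sum w k l - z1) * ((1 - Cconj w * z1) ^ 2 + k * z1 ^ 2)
    - (2 * h * z1 + 2 * (w - z1) * (1 - Cconj w * z1)) = 0)
    by (rewrite <- Hsum, <- S1; ring).
  unfold vertex_sum in S1'; unfold closing_point in R1.
  apply (linear_combination2 (- (Cconj w ^ 2 + k)) (- (1)) _ _ _ _ _ _ R1 S1'); ring.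
Qed.

(** The third side comes for free: under the closure relation, once z solves B(z) = l, the
line determined by the two remaining roots of the cubic is tangent, whether or not these
roots are known to lie on the unit circle. *)
Lemma opposite_chord_tangent (w : C) (k h : R) (l z s p : C) :
  closure_relation w k h -> closing_point w k l z -> z <> 0 ->
  z + s = vertex_sum w k l -> z * p = l ->
  chord_tangent w k h s p.
Proof.
  unfold closure_relation, closing_point, vertex_sum, chord_tangent.
  intros Hcl Hz Nz Hs Hp.
  assert (Es : s = 2 * w + l * (Cconj w ^ 2 + k) - z) by (rewrite <- Hs; ring).
  assert (Ep : p = l / z) by (rewrite <- Hp; field; exact Nz).
  apply (Cmult_eq0 (z ^ 2)).
  2: apply Cpow_nz, Nz.
  (* Modulo the closure relation, z^2 times the claim is the cubic times z - l (conj w^2 + k). *)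
  apply (linear_combination2 (z - l * (Cconj w ^ 2 + k)) (- l * z) _ _ _ _ _ _ Hz Hcl).
  rewrite Es, Ep; field; exact Nz.
Qed.

(** The cubic is self-inversive, so its two roots other than z have the symmetric functions
of a real line, even before they are known to lie on the unit circle. *)
Lemma opposite_chord_conj (w : C) (k : R) (l z s p : C) :
  closing_point w k l z -> on_unit_circle z -> on_unit_circle l ->
  z + s = vertex_sum w k l -> z * p = l ->
  s = p * Cconj s.
Proof.
  intros Hz Uz Ul Hs Hp.
  assert (Nz := on_unit_circle_neq0 z Uz).
  assert (Nl := on_unit_circle_neq0 l Ul).
  apply closing_point_cubic in Hz; unfold vertex_sum in *.
  assert (Es : s = 2 * w + l * (Cconj w ^ 2 + k) - z) by (rewrite <- Hs; ring).
  assert (Ep : p = l / z) by (rewrite <- Hp; field; exact Nz).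
  rewrite Ep, Es.
  rewrite Cminus_conj, Cplus_conj, !Cmult_conj, Cplus_conj, Cpow_conj, !RtoC_conj, Cconj_conj,
    (on_unit_circle_conj z Uz), (on_unit_circle_conj l Ul).
  apply (linear_combination1 (- / z ^ 2) _ _ _ _ Hz).
  field; split; assumption.
Qed.

(** For two points z1, z2 of the unit circle, the bracket on the left is the squared distance
condition for the line z1 z2, so the two forms of tangency agree when z1 and z2 differ. *)
Lemma tangency_real_form (w z1 z2 : C) (k h : R) :
  on_unit_circle z1 -> on_unit_circle z2 ->
  4 * z1 * z2 *
    RtoC (((fst z2 - fst z1) * (snd w - snd z1) - (snd z2 - snd z1) * (fst w - fst z1)) ^ 2
      - ((h + k) / 2 * (fst z2 - fst z1) ^ 2 + (h - k) / 2 * (snd z2 - snd z1) ^ 2))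
  = RtoC ((fst z2 - fst z1) ^ 2 + (snd z2 - snd z1) ^ 2) *
    ((w + z1 * z2 * Cconj w - (z1 + z2)) ^ 2 + k * (1 + (z1 * z2) ^ 2) - 2 * h * (z1 * z2)).
Proof.
  intros U1 U2.
  assert (N1 := on_unit_circle_neq0 _ U1); assert (N2 := on_unit_circle_neq0 _ U2).
  destruct (coordinates_of_conj z1) as [X1 Y1].
  destruct (coordinates_of_conj z2) as [X2 Y2].
  destruct (coordinates_of_conj w) as [X Y].
  rewrite (on_unit_circle_conj _ U1) in X1, Y1.
  rewrite (on_unit_circle_conj _ U2) in X2, Y2.
  unfold Rdiv.
  repeat rewrite ?RtoC_plus, ?RtoC_minus, ?RtoC_mult, ?RtoC_pow.
  rewrite (RtoC_inv 2) by lra.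
  rewrite X1, X2, X, Y1, Y2, Y.
  assert (HI := Ci_square).
  field [HI]; repeat split; try assumption.
  all: intros H; apply (f_equal fst) in H; simpl in H; lra.
Qed.

(** The same comparison for a line given by its unit normal rho and its distance kappa from
the origin.  It also covers tangent lines of the unit circle, and lines that miss it. *)
Lemma tangency_normal_form (w rho : C) (k h kappa : R) :
  on_unit_circle rho ->
  (w + rho ^ 2 * Cconj w - 2 * rho * kappa) ^ 2 + k * (1 + (rho ^ 2) ^ 2) - 2 * h * rho ^ 2
  = 4 * rho ^ 2 *
    RtoC ((fst w * fst rho + snd w * snd rho - kappa) ^ 2
      - ((h - k) / 2 * fst rho ^ 2 + (h + k) / 2 * snd rho ^ 2)).
Proof.
  intros U.
  assert (N := on_unit_circle_neq0 _ U).
  destruct (coordinates_of_conj rho) as [X1 Y1].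
  destruct (coordinates_of_conj w) as [X Y].
  rewrite (on_unit_circle_conj _ U) in X1, Y1.
  unfold Rdiv.
  repeat rewrite ?RtoC_plus, ?RtoC_minus, ?RtoC_mult, ?RtoC_pow.
  rewrite (RtoC_inv 2) by lra.
  rewrite X1, X, Y1, Y.
  assert (HI := Ci_square).
  field [HI]; repeat split; try assumption.
  all: intros H; apply (f_equal fst) in H; simpl in H; lra.
Qed.

Local Close Scope C_scope.

(** * From the ellipse to the unit circle *)

Definition to_unit (a b : R) (P : point) : C := (fst P / a, snd P / b).
Definition of_unit (a b : R) (z : C) : point := (a * fst z, b * snd z).

(** Squared half focal distance of the image of the circle under the scaling; its semiaxes
are r / a and r / b, so its major axis is vertical. *)
Definition focal_par (a b r : R) : R := r ^ 2 * (/ b ^ 2 - / a ^ 2).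

(** Sum of the squared semiaxes of the image of the circle under the scaling. *)
Definition axes_par (a b r : R) : R := r ^ 2 * (/ a ^ 2 + / b ^ 2).

(** The difference of the two squares is 4 r^4 / (a b)^2. *)
Lemma axes_par_neq_focal_par (a b r : R) : 0 < b -> 0 < a -> 0 < r -> axes_par a b r ^ 2 <> focal_par a b r ^ 2.
Proof.
  intros Hb Ha Hr E.
  assert (E' : 4 * r ^ 4 / (a ^ 2 * b ^ 2) = 0).
  { transitivity (axes_par a b r ^ 2 - focal_par a b r ^ 2);
      [unfold axes_par, focal_par; field; lra | rewrite E; ring]. }
  assert (0 < 4 * r ^ 4 / (a ^ 2 * b ^ 2)); [|lra].
  apply Rdiv_lt_0_compat; [|apply Rmult_lt_0_compat; apply pow_lt; lra].
  apply Rmult_lt_0_compat; [lra | apply pow_lt; lra].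
Qed.

Lemma focal_par_gt0 (a b r : R) : 0 < b -> b < a -> 0 < r -> 0 < focal_par a b r.
Proof.
  intros; unfold focal_par; apply Rmult_lt_0_compat; [apply pow_lt; lra|].
  apply Rlt_0_minus, Rinv_lt_contravar; [apply Rmult_lt_0_compat; apply pow_lt; lra | nra].
Qed.

Lemma of_unitK (a b : R) (z : C) : a <> 0 -> b <> 0 -> to_unit a b (of_unit a b z) = z.
Proof.
  intros; apply injective_projections; unfold to_unit, of_unit; simpl; field; assumption.
Qed.

Lemma to_unitK (a b : R) (P : point) : a <> 0 -> b <> 0 -> of_unit a b (to_unit a b P) = P.
Proof.
  intros; apply injective_projections; unfold to_unit, of_unit; simpl; field; assumption.
Qed.

Lemma on_ellipse_to_unit (a b : R) (P : point) :
  a <> 0 -> b <> 0 -> on_ellipse a b P <-> on_unit_circle (to_unit a b P).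
Proof.
  intros Ha Hb; rewrite on_unit_circle_coord; unfold on_ellipse, to_unit; simpl fst; simpl snd.
  replace (fst P / a * (fst P / a) + snd P / b * (snd P / b))
    with (fst P ^ 2 / a ^ 2 + snd P ^ 2 / b ^ 2) by (field; split; assumption).
  reflexivity.
Qed.

Lemma pdist_sq (P Q : point) :
  pdist P Q ^ 2 = (fst P - fst Q) ^ 2 + (snd P - snd Q) ^ 2.
Proof.
  unfold pdist, dist_euc; rewrite <- Rsqr_pow2, Rsqr_sqrt.
  - unfold Rsqr; ring.
  - apply Rplus_le_le_0_compat; apply Rle_0_sqr.
Qed.

Lemma pdist_ge0 (P Q : point) : 0 <= pdist P Q.
Proof. apply sqrt_pos. Qed.

Lemma sum_sq_eq0 (x y : R) : x ^ 2 + y ^ 2 = 0 -> x = 0 /\ y = 0.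
Proof.
  intros H; assert (0 <= x ^ 2) by apply pow2_ge_0; assert (0 <= y ^ 2) by apply pow2_ge_0.
  split; apply Rsqr_0_uniq; rewrite Rsqr_pow2; lra.
Qed.

Lemma sum_sq_gt0 (x y : R) : (x, y) <> (0, 0) -> 0 < x ^ 2 + y ^ 2.
Proof.
  intros H; assert (0 <= x ^ 2) by apply pow2_ge_0; assert (0 <= y ^ 2) by apply pow2_ge_0.
  destruct (Req_dec (x ^ 2 + y ^ 2) 0) as [E|]; [|lra].
  apply sum_sq_eq0 in E; destruct E as [-> ->]; exfalso; apply H; reflexivity.
Qed.

Lemma pow2_inj_nonneg (x y : R) : 0 <= x -> 0 <= y -> x ^ 2 = y ^ 2 -> x = y.
Proof. intros; nra. Qed.

Lemma on_circle_sq (c P : point) (rho : R) :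
  0 <= rho ->
  on_circle c rho P <-> (fst P - fst c) ^ 2 + (snd P - snd c) ^ 2 = rho ^ 2.
Proof.
  intros Hr; unfold on_circle; rewrite <- pdist_sq; split.
  - intros ->; reflexivity.
  - apply pow2_inj_nonneg; [apply pdist_ge0 | exact Hr].
Qed.

(** Tangency of a side says that the squared distance from the center to its line is r^2; the
scaling turns this into the bracket of [tangency_real_form]. *)
Lemma side_tangent_chord_tangent (a b r : R) (c P Q : point) :
  0 < b -> 0 < a -> 0 < r -> P <> Q ->
  on_ellipse a b P -> on_ellipse a b Q -> side_tangent c r P Q ->
  chord_tangent (to_unit a b c) (focal_par a b r) (axes_par a b r)
    (to_unit a b P + to_unit a b Q)%C (to_unit a b P * to_unit a b Q)%C.
Proof.
  intros Hb Ha Hr Hne HP HQ [s [_ [HM Hperp]]].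
  apply on_ellipse_to_unit in HP; [|lra|lra]; apply on_ellipse_to_unit in HQ; [|lra|lra].
  unfold chord_tangent.
  assert (E := tangency_real_form (to_unit a b c) _ _ (focal_par a b r) (axes_par a b r) HP HQ).
  apply on_circle_sq in HM; [|lra].
  destruct P as [x1 y1], Q as [x2 y2], c as [xc yc]; simpl fst in *; simpl snd in *.
  match type of E with (_ * RtoC ?z = RtoC ?n * _)%C =>
    assert (Z : z = 0); [|assert (Nn : n <> 0)] end.
  - set (M1 := x1 + s * (x2 - x1)) in *; set (M2 := y1 + s * (y2 - y1)) in *.
    assert (Hcr : ((x2 - x1) * (yc - y1) - (y2 - y1) * (xc - x1)) ^ 2
                  = r ^ 2 * ((x2 - x1) ^ 2 + (y2 - y1) ^ 2)).
    { rewrite <- HM.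
      replace ((x2 - x1) * (yc - y1) - (y2 - y1) * (xc - x1))
        with ((y2 - y1) * (M1 - xc) - (x2 - x1) * (M2 - yc)) by (unfold M1, M2; ring).
      replace (((y2 - y1) * (M1 - xc) - (x2 - x1) * (M2 - yc)) ^ 2) with
        (((M1 - xc) ^ 2 + (M2 - yc) ^ 2) * ((x2 - x1) ^ 2 + (y2 - y1) ^ 2)
          - ((M1 - xc) * (x2 - x1) + (M2 - yc) * (y2 - y1)) ^ 2) by ring.
      rewrite Hperp; ring. }
    unfold focal_par, axes_par.
    transitivity ((((x2 - x1) * (yc - y1) - (y2 - y1) * (xc - x1)) ^ 2
      - r ^ 2 * ((x2 - x1) ^ 2 + (y2 - y1) ^ 2)) / (a ^ 2 * b ^ 2)).
    + field; lra.
    + rewrite Hcr; field; lra.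
  - intros H; apply Hne.
    apply sum_sq_eq0 in H; destruct H as [E1 E2].
    assert (F1 : x2 - x1 = 0) by (replace (x2 - x1) with (a * (x2 / a - x1 / a)) by (field; lra); rewrite E1; ring).
    assert (F2 : y2 - y1 = 0) by (replace (y2 - y1) with (b * (y2 / b - y1 / b)) by (field; lra); rewrite E2; ring).
    f_equal; lra.
  - rewrite Z in E.
    match type of E with (_ = RtoC ?n * _)%C => apply (Cmult_eq0 (RtoC n)) end.
    + rewrite <- E; ring.
    + intros H; apply Nn, RtoC_inj, H.
Qed.

Definition circle_inside (a b : R) (c : point) (r : R) : Prop :=
  forall P, on_circle c r P -> inside_ellipse a b P.

(** The contact point is the foot of the perpendicular from the center.  The hypothesis is
the tangency condition written in scaled coordinates, where n is a normal vector of the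
scaled line. *)
Lemma tangent_line_contact (a b r kappa : R) (c n : point) :
  0 < b -> 0 < a -> 0 < r -> circle_inside a b c r -> n <> (0, 0) ->
  (fst c / a * fst n + snd c / b * snd n - kappa) ^ 2
    = r ^ 2 * (fst n ^ 2 / a ^ 2 + snd n ^ 2 / b ^ 2) ->
  exists (M : point) (t : R),
    on_circle c r M /\ inside_ellipse a b M /\
    fst M / a * fst n + snd M / b * snd n = kappa /\
    fst M - fst c = t * (fst n / a) /\ snd M - snd c = t * (snd n / b).
Proof.
  intros Hb Ha Hr Hin Hn Htan.
  destruct c as [xc yc], n as [u v]; simpl fst in *; simpl snd in *.
  assert (Huv : 0 < u ^ 2 + v ^ 2).
  { apply sum_sq_gt0, Hn. }
  set (q := u ^ 2 / a ^ 2 + v ^ 2 / b ^ 2) in *.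
  assert (Hq : 0 < q).
  { replace q with ((u / a) ^ 2 + (v / b) ^ 2) by (unfold q; field; lra).
    apply sum_sq_gt0; intros H; injection H; intros H2 H1; apply Hn.
    replace u with (u / a * a) by (field; lra); replace v with (v / b * b) by (field; lra).
    rewrite H1, H2; f_equal; ring. }
  set (d := kappa - (xc / a * u + yc / b * v)).
  assert (HMc : on_circle (xc, yc) r (xc + d / q * (u / a), yc + d / q * (v / b))).
  { apply on_circle_sq; [lra|]; simpl fst; simpl snd.
    transitivity (d ^ 2 / q ^ 2 * q).
    - unfold q; field; repeat split; try lra; unfold q in Hq.
      replace ((u * b) ^ 2 + (v * a) ^ 2) with
        ((u ^ 2 / a ^ 2 + v ^ 2 / b ^ 2) * (a ^ 2 * b ^ 2)) by (field; lra).
      apply Rgt_not_eq, Rmult_lt_0_compat; [exact Hq | apply Rmult_lt_0_compat; apply pow_lt; lra].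
    - replace (d ^ 2) with (r ^ 2 * q) by (rewrite <- Htan; unfold d; ring).
      field; lra. }
  exists (xc + d / q * (u / a), yc + d / q * (v / b)), (d / q).
  split; [exact HMc|]; split; [apply Hin, HMc|]; simpl fst; simpl snd; split; [|split; ring].
  transitivity (xc / a * u + yc / b * v + d / q * q).
  - unfold q at 4; field; lra.
  - unfold d; field; lra.
Qed.

(** The contact point lies on the line and, by hypothesis on the circle, strictly inside the
ellipse; so the scaled line has a point in the open unit disc. *)
Lemma tangent_line_meets_disc (a b r kappa : R) (c n : point) :
  0 < b -> 0 < a -> 0 < r -> circle_inside a b c r -> n <> (0, 0) ->
  (fst c / a * fst n + snd c / b * snd n - kappa) ^ 2
    = r ^ 2 * (fst n ^ 2 / a ^ 2 + snd n ^ 2 / b ^ 2) ->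
  kappa ^ 2 < fst n ^ 2 + snd n ^ 2.
Proof.
  intros Hb Ha Hr Hin Hn Htan.
  destruct (tangent_line_contact a b r kappa c n Hb Ha Hr Hin Hn Htan)
    as [[x y] [t [_ [HM [<- _]]]]].
  unfold inside_ellipse in HM; destruct n as [u v]; simpl fst in *; simpl snd in *.
  replace (x ^ 2 / a ^ 2 + y ^ 2 / b ^ 2) with ((x / a) ^ 2 + (y / b) ^ 2) in HM by (field; lra).
  set (X := x / a) in *; set (Y := y / b) in *.
  assert (Huv : 0 < u ^ 2 + v ^ 2).
  { apply sum_sq_gt0, Hn. }
  assert (0 <= (X * v - Y * u) ^ 2) by apply pow2_ge_0.
  assert ((X ^ 2 + Y ^ 2) * (u ^ 2 + v ^ 2) < 1 * (u ^ 2 + v ^ 2)) by (apply Rmult_lt_compat_r; lra).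
  replace ((X * u + Y * v) ^ 2)
    with ((X ^ 2 + Y ^ 2) * (u ^ 2 + v ^ 2) - (X * v - Y * u) ^ 2) by ring.
  lra.
Qed.

(** Endpoints of a tangent chord cannot coincide, because the tangent to the unit circle misses
the open disc; and the contact point lies on the segment, because a line meets the open disc
between its two points on the unit circle. *)
Lemma chord_tangent_side_tangent (a b r : R) (c : point) (z1 z2 : C) :
  0 < b -> 0 < a -> 0 < r -> circle_inside a b c r ->
  on_unit_circle z1 -> on_unit_circle z2 ->
  chord_tangent (to_unit a b c) (focal_par a b r) (axes_par a b r) (z1 + z2)%C (z1 * z2)%C ->
  z1 <> z2 /\ side_tangent c r (of_unit a b z1) (of_unit a b z2).
Proof.
  intros Hb Ha Hr Hin U1 U2 T.
  assert (Hne : z1 <> z2).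
  { intros <-.
    assert (E := tangency_normal_form (to_unit a b c) z1 (focal_par a b r) (axes_par a b r) 1 U1).
    match type of E with (_ = _ * RtoC ?z)%C => assert (Z : z = 0) end.
    { apply RtoC_inj, (Cmult_eq0 (4 * z1 ^ 2)%C).
      - rewrite <- E, <- T; ring.
      - apply Cmult_neq_0; [|apply Cpow_nz, on_unit_circle_neq0, U1].
        intros H; apply RtoC_inj in H; lra. }
    apply on_unit_circle_coord in U1.
    assert (L := tangent_line_meets_disc a b r 1 c z1 Hb Ha Hr Hin).
    assert (1 ^ 2 < fst z1 ^ 2 + snd z1 ^ 2); [apply L | nra].
    - intros ->; simpl in U1; lra.
    - apply Rminus_diag_uniq; rewrite <- Z; unfold to_unit, focal_par, axes_par; simpl fst; simpl snd; field; lra. }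
  split; [exact Hne|].
  destruct z1 as [x1 y1], z2 as [x2 y2].
  assert (Hd : 0 < (x2 - x1) ^ 2 + (y2 - y1) ^ 2).
  { apply sum_sq_gt0; intros H; injection H; intros; apply Hne; f_equal; lra. }
  assert (E := tangency_real_form (to_unit a b c) _ _ (focal_par a b r) (axes_par a b r) U1 U2).
  unfold chord_tangent in T; rewrite T in E.
  match type of E with (_ * RtoC ?z = _)%C => assert (Z : z = 0) end.
  { apply RtoC_inj, (Cmult_eq0 (4 * (x1, y1) * (x2, y2))%C).
    - rewrite E; ring.
    - apply Cmult_neq_0; [|apply on_unit_circle_neq0, U2].
      apply Cmult_neq_0; [|apply on_unit_circle_neq0, U1].
      intros H; apply RtoC_inj in H; lra. }
  apply on_unit_circle_coord in U1; apply on_unit_circle_coord in U2.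
  unfold to_unit in Z; simpl fst in *; simpl snd in *.
  (* The normal vector is the chord turned by a right angle. *)
  destruct (tangent_line_contact a b r (- (y2 - y1) * x1 + (x2 - x1) * y1) c
              (- (y2 - y1), x2 - x1) Hb Ha Hr Hin)
    as [[mx my] [t [HMc [HMin [Hline [Hx Hy]]]]]].
  - intros H; injection H; intros H1 H2; rewrite H1 in Hd; replace (y2 - y1) with 0 in Hd by lra; lra.
  - simpl fst; simpl snd.
    apply Rminus_diag_uniq; rewrite <- Z; unfold focal_par, axes_par; field; lra.
  - unfold inside_ellipse in HMin; simpl fst in *; simpl snd in *.
    replace (mx ^ 2 / a ^ 2 + my ^ 2 / b ^ 2) with ((mx / a) ^ 2 + (my / b) ^ 2) in HMin by (field; lra).
    set (X := mx / a) in *; set (Y := my / b) in *.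
    assert (Emx : mx = a * X) by (unfold X; field; lra).
    assert (Emy : my = b * Y) by (unfold Y; field; lra).
    set (n := (x2 - x1) ^ 2 + (y2 - y1) ^ 2) in *.
    set (s := ((X - x1) * (x2 - x1) + (Y - y1) * (y2 - y1)) / n).
    assert (Hs : s * n = (X - x1) * (x2 - x1) + (Y - y1) * (y2 - y1)) by (unfold s; field; lra).
    assert (EX : X = x1 + s * (x2 - x1)).
    { apply (Rmult_eq_reg_r n); [|lra].
      replace ((x1 + s * (x2 - x1)) * n) with (x1 * n + (s * n) * (x2 - x1)) by ring.
      rewrite Hs; unfold n.
      apply Rminus_diag_uniq; apply Rminus_diag_eq in Hline.
      transitivity ((y1 - y2) * (X * - (y2 - y1) + Y * (x2 - x1)
        - (- (y2 - y1) * x1 + (x2 - x1) * y1))); [ring | rewrite Hline; ring]. }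
    assert (EY : Y = y1 + s * (y2 - y1)).
    { apply (Rmult_eq_reg_r n); [|lra].
      replace ((y1 + s * (y2 - y1)) * n) with (y1 * n + (s * n) * (y2 - y1)) by ring.
      rewrite Hs; unfold n.
      apply Rminus_diag_uniq; apply Rminus_diag_eq in Hline.
      transitivity ((x2 - x1) * (X * - (y2 - y1) + Y * (x2 - x1)
        - (- (y2 - y1) * x1 + (x2 - x1) * y1))); [ring | rewrite Hline; ring]. }
    exists s; split.
    + assert (Hprod : 0 < s * (1 - s) * n).
      { replace (s * (1 - s) * n) with ((1 - s) * (x1 * x1 + y1 * y1)
          + s * (x2 * x2 + y2 * y2) - (X ^ 2 + Y ^ 2)) by (rewrite EX, EY; unfold n; ring).
        rewrite U1, U2; lra. }
      assert (Hss : 0 < s * (1 - s)) by (apply (Rmult_lt_reg_r n); lra).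
      split; nra.
    + unfold of_unit; simpl fst; simpl snd.
      replace (a * x1 + s * (a * x2 - a * x1)) with mx by (rewrite Emx, EX; ring).
      replace (b * y1 + s * (b * y2 - b * y1)) with my by (rewrite Emy, EY; ring).
      split; [exact HMc|].
      rewrite Hx, Hy; field; lra.
Qed.

(** * The porism: triangles parametrized by their vertex product *)

(** Three distinct points of a circle are never collinear. *)
Lemma unit_triangle_cross (z1 z2 z3 : C) :
  on_unit_circle z1 -> on_unit_circle z2 -> on_unit_circle z3 ->
  (2 * Ci * (z1 * z2 * z3) *
    RtoC ((fst z2 - fst z1) * (snd z3 - snd z1) - (snd z2 - snd z1) * (fst z3 - fst z1))
  = (z2 - z1) * (z3 - z1) * (z2 - z3))%C.
Proof.
  intros U1 U2 U3.
  assert (N1 := on_unit_circle_neq0 _ U1); assert (N2 := on_unit_circle_neq0 _ U2).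
  assert (N3 := on_unit_circle_neq0 _ U3).
  destruct (coordinates_of_conj z1) as [X1 Y1].
  destruct (coordinates_of_conj z2) as [X2 Y2].
  destruct (coordinates_of_conj z3) as [X3 Y3].
  rewrite (on_unit_circle_conj _ U1) in X1, Y1.
  rewrite (on_unit_circle_conj _ U2) in X2, Y2.
  rewrite (on_unit_circle_conj _ U3) in X3, Y3.
  repeat rewrite ?RtoC_plus, ?RtoC_minus, ?RtoC_mult.
  rewrite X1, X2, X3, Y1, Y2, Y3.
  assert (HI := Ci_square).
  field [HI]; repeat split; try assumption.
  all: intros H; apply (f_equal fst) in H; simpl in H; lra.
Qed.

Definition vertex_product (a b : R) (t : plane_triangle) : C :=
  (to_unit a b (vA t) * to_unit a b (vB t) * to_unit a b (vC t))%C.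

Lemma nondegenerate_distinct (t : plane_triangle) :
  nondegenerate t -> vA t <> vB t /\ vA t <> vC t /\ vB t <> vC t.
Proof.
  unfold nondegenerate; intros H; repeat split; intros E; apply H; rewrite E; ring.
Qed.

Lemma to_unit_inj (a b : R) (P Q : point) :
  a <> 0 -> b <> 0 -> to_unit a b P = to_unit a b Q -> P = Q.
Proof.
  intros Ha Hb E; rewrite <- (to_unitK a b P), <- (to_unitK a b Q), E by assumption; reflexivity.
Qed.

(** What the elimination needs to know about a Poncelet triangle, in scaled coordinates. *)
Record poncelet_relations (a b : R) (c : point) (r : R) (t : plane_triangle) : Prop := {
  rel_unitA : on_unit_circle (to_unit a b (vA t));
  rel_unitB : on_unit_circle (to_unit a b (vB t));
  rel_unitC : on_unit_circle (to_unit a b (vC t));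
  rel_AB : to_unit a b (vA t) <> to_unit a b (vB t);
  rel_AC : to_unit a b (vA t) <> to_unit a b (vC t);
  rel_BC : to_unit a b (vB t) <> to_unit a b (vC t);
  rel_tanAB : chord_tangent (to_unit a b c) (focal_par a b r) (axes_par a b r)
    (to_unit a b (vA t) + to_unit a b (vB t))%C (to_unit a b (vA t) * to_unit a b (vB t))%C;
  rel_tanAC : chord_tangent (to_unit a b c) (focal_par a b r) (axes_par a b r)
    (to_unit a b (vA t) + to_unit a b (vC t))%C (to_unit a b (vA t) * to_unit a b (vC t))%C;
  rel_tanBC : chord_tangent (to_unit a b c) (focal_par a b r) (axes_par a b r)
    (to_unit a b (vB t) + to_unit a b (vC t))%C (to_unit a b (vB t) * to_unit a b (vC t))%C }.

Lemma poncelet_triangle_relations (a b r : R) (c : point) (t : plane_triangle) :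
  0 < b -> 0 < a -> 0 < r -> poncelet_triangle a b c r t -> poncelet_relations a b c r t.
Proof.
  intros Hb Ha Hr [Hnd [HE [TAB [TBC TCA]]]].
  destruct (nondegenerate_distinct t Hnd) as [NAB [NAC NBC]].
  assert (EA : on_ellipse a b (vA t)) by (apply HE; left; reflexivity).
  assert (EB : on_ellipse a b (vB t)) by (apply HE; right; left; reflexivity).
  assert (EC : on_ellipse a b (vC t)) by (apply HE; right; right; reflexivity).
  split; try (apply on_ellipse_to_unit; [lra | lra | assumption]).
  1-3: intros E; apply to_unit_inj in E; [contradiction | lra | lra].
  - apply side_tangent_chord_tangent; assumption.
  - rewrite Cplus_comm, Cmult_comm.
    apply side_tangent_chord_tangent; try assumption; intros E; apply NAC; symmetry; exact E.
  - apply side_tangent_chord_tangent; assumption.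
Qed.

Lemma poncelet_vertex_sum (a b r : R) (c : point) (t : plane_triangle) :
  poncelet_relations a b c r t ->
  (to_unit a b (vA t) + to_unit a b (vB t) + to_unit a b (vC t))%C
    = vertex_sum (to_unit a b c) (focal_par a b r) (vertex_product a b t) /\
  closure_relation (to_unit a b c) (focal_par a b r) (axes_par a b r).
Proof.
  intros [UA UB UC NAB NAC NBC TAB TAC TBC].
  destruct (tangent_triangle_relations _ _ _ _ _ _ NAB NAC NBC (on_unit_circle_neq0 _ UA) TAB TAC TBC)
    as [_ H]; exact H.
Qed.

(** B(z) is a quotient, and its denominator does not vanish at z: otherwise both tangents from
z would degenerate, forcing h^2 = k^2. *)
Lemma closing_point_determines_product (w z z2 z3 l l' : C) (k h : R) :
  h ^ 2 <> k ^ 2 -> z <> 0%C -> z2 <> z3 ->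
  chord_tangent w k h (z + z2)%C (z * z2)%C ->
  chord_tangent w k h (z + z3)%C (z * z3)%C ->
  closing_point w k l z -> closing_point w k l' z -> l = l'.
Proof.
  intros Hhk Nz N23 T2 T3 H H'.
  destruct (second_intersections _ _ _ _ _ _ N23 T2 T3) as [S P].
  unfold closing_point in H, H'.
  set (D := ((1 - Cconj w * z) ^ 2 + k * z ^ 2)%C) in *.
  assert (ND : D <> 0%C).
  { intros E; rewrite E, Cmult_0_r in P, S.
    apply Hhk, RtoC_inj; rewrite !RtoC_pow.
    apply Csub_eq0, (Cmult_eq0 (z ^ 2)%C); [|apply Cpow_nz, Nz].
    (* If D = 0 then both Vieta formulas degenerate and h z = (z - w) (1 - conj w z); squaring gives h^2 = k^2. *)
    assert (S2 : (h * z - (z - w) * (1 - Cconj w * z) = 0)%C).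
    { apply (Cmult_eq0 2%C); [rewrite S; ring | intros F; apply RtoC_inj in F; lra]. }
    apply (linear_combination3 (h * z + (z - w) * (1 - Cconj w * z))%C
      (- (1 - Cconj w * z) ^ 2)%C (- k)%C _ _ _ _ _ _ _ _ S2 P E).
    unfold D; ring_simplify; reflexivity. }
  apply Csub_eq0, (Cmult_eq0 D); [|exact ND].
  apply (linear_combination2 (- (1))%C 1%C _ _ _ _ _ _ H H'); ring.
Qed.

Lemma poncelet_relations_rotate (a b r : R) (c : point) (A B C : point) :
  poncelet_relations a b c r (Triangle A B C) -> poncelet_relations a b c r (Triangle B C A).
Proof.
  intros [UA UB UC NAB NAC NBC TAB TAC TBC]; simpl in *.
  split; simpl; try assumption; try (apply neq_sym; assumption);
    apply chord_tangent_sym; assumption.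
Qed.

Lemma poncelet_closing_point (a b r : R) (c : point) (t : plane_triangle) (P : point) :
  poncelet_relations a b c r t -> is_vertex t P ->
  closing_point (to_unit a b c) (focal_par a b r) (vertex_product a b t) (to_unit a b P).
Proof.
  assert (HA : forall t, poncelet_relations a b c r t ->
    closing_point (to_unit a b c) (focal_par a b r) (vertex_product a b t) (to_unit a b (vA t))).
  { intros t' [UA UB UC NAB NAC NBC TAB TAC TBC].
    apply (tangent_triangle_relations _ _ _ _ _ _ NAB NAC NBC (on_unit_circle_neq0 _ UA) TAB TAC TBC). }
  intros H; destruct t as [A B C].
  assert (HB := poncelet_relations_rotate _ _ _ _ _ _ _ H).
  assert (HC := poncelet_relations_rotate _ _ _ _ _ _ _ HB).
  intros [-> | [-> | ->]]; simpl.
  - apply (HA (Triangle A B C)), H.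
  - replace (vertex_product a b (Triangle A B C)) with (vertex_product a b (Triangle B C A))
      by (unfold vertex_product; simpl; ring).
    apply (HA (Triangle B C A)), HB.
  - replace (vertex_product a b (Triangle A B C)) with (vertex_product a b (Triangle C A B))
      by (unfold vertex_product; simpl; ring).
    apply (HA (Triangle C A B)), HC.
Qed.

(** The product is B(z) at any vertex z, so one common vertex is enough. *)
Lemma same_triangle_vertex_product (a b r : R) (c : point) (t t' : plane_triangle) :
  0 < b -> 0 < a -> 0 < r ->
  poncelet_relations a b c r t -> poncelet_relations a b c r t' ->
  same_triangle t t' -> vertex_product a b t = vertex_product a b t'.
Proof.
  intros Hb Ha Hr H H' Hs.
  destruct (H) as [UA UB UC NAB NAC NBC TAB TAC TBC].
  apply (closing_point_determines_product _ _ _ _ _ _ _ _ (axes_par_neq_focal_par a b r Hb Ha Hr)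
    (on_unit_circle_neq0 _ UA) NBC TAB TAC).
  - apply (poncelet_closing_point a b r c t); [exact H | left; reflexivity].
  - apply (poncelet_closing_point a b r c t'); [exact H'|].
    apply Hs; left; reflexivity.
Qed.

(** With l = mu^2 and z = zeta^2, the equation B(z) = l follows from the vanishing of the
imaginary part of conj mu conj zeta ((zeta^2 - w)^2 + k).  This function is odd in zeta, so it
takes opposite values at zeta = 1 and zeta = -1 and vanishes on the half circle between them. *)
Lemma closing_point_exists (w l : C) (k : R) :
  on_unit_circle l -> exists z, on_unit_circle z /\ closing_point w k l z.
Proof.
  intros Ul; destruct (unit_sqrt l Ul) as [mu [Umu Hmu]].
  (* The angle runs over [0, PI] only: at its ends zeta is 1 and -1. *)
  set (F := fun zeta : C => (Cconj mu * Cconj zeta * ((zeta ^ 2 - w) ^ 2 + k))%C).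
  set (phi := fun th : R => snd (F (cos th, sin th))).
  assert (Hc : Ranalysis1.continuity phi).
  { intros th; apply derivable_continuous_pt.
    apply ex_derive_Reals_0.
    unfold phi, F; simpl; auto_derive; trivial. }
  assert (Hodd : phi PI = - phi 0).
  { unfold phi; rewrite cos_PI, sin_PI, cos_0, sin_0.
    replace ((-1, 0) : C) with (- (1, 0))%C by (apply injective_projections; simpl; ring).
    transitivity (snd (- F (1, 0))%C); [|reflexivity].
    f_equal; unfold F; rewrite Copp_conj; ring. }
  destruct (IVT_gen phi 0 PI 0 Hc) as [th [_ Hth]].
  { rewrite Hodd; unfold Rmin, Rmax; destruct (Rle_dec _ _); lra. }
  set (zeta := (cos th, sin th) : C).
  assert (Uz : on_unit_circle zeta).
  { apply on_unit_circle_coord; simpl; rewrite Rplus_comm; apply sin2_cos2. }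
  exists (zeta ^ 2)%C; split.
  - replace (zeta ^ 2)%C with (zeta * zeta)%C by ring; apply on_unit_circle_mult; exact Uz.
  - assert (HF : Cconj (F zeta) = F zeta).
    { unfold phi in Hth; fold zeta in Hth.
      apply injective_projections; [reflexivity|].
      change (- snd (F zeta) = snd (F zeta)); rewrite Hth; ring. }
    unfold F in HF.
    rewrite !Cmult_conj, Cplus_conj, Cpow_conj, Cminus_conj, Cpow_conj, !Cconj_conj, RtoC_conj,
      (on_unit_circle_conj _ Umu), (on_unit_circle_conj _ Uz) in HF.
    assert (Nz := on_unit_circle_neq0 _ Uz); assert (Nm := on_unit_circle_neq0 _ Umu).
    unfold closing_point.
    apply (linear_combination1 (- mu * zeta ^ 3)%C _ _ _ _ HF).
    rewrite <- Hmu; field; split; assumption.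
Qed.

(** The line with the symmetric functions of the two missing roots touches the scaled circle,
hence crosses the open unit disc; its two points on the unit circle are the missing roots. *)
Lemma remaining_vertices_exist (l z : C) (a b r : R) (c : point) :
  0 < b -> 0 < a -> 0 < r -> circle_inside a b c r ->
  closure_relation (to_unit a b c) (focal_par a b r) (axes_par a b r) ->
  on_unit_circle l -> on_unit_circle z ->
  closing_point (to_unit a b c) (focal_par a b r) l z ->
  exists z2 z3, on_unit_circle z2 /\ on_unit_circle z3 /\
    z2 <> z3 /\ (z + (z2 + z3) = vertex_sum (to_unit a b c) (focal_par a b r) l)%C /\
    (z * (z2 * z3) = l)%C.
Proof.
  intros Hb Ha Hr Hin Hcl Ul Uz Hz.
  assert (Nz := on_unit_circle_neq0 _ Uz).
  set (p := (l * Cconj z)%C); set (s := (vertex_sum (to_unit a b c) (focal_par a b r) l - z)%C).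
  assert (Hs : (z + s = vertex_sum (to_unit a b c) (focal_par a b r) l)%C) by (unfold s; ring).
  assert (Hp : (z * p = l)%C).
  { unfold p; rewrite (on_unit_circle_conj _ Uz); field; exact Nz. }
  assert (Up : on_unit_circle p) by (apply on_unit_circle_mult; [exact Ul | apply on_unit_circle_Cconj, Uz]).
  assert (Hconj := opposite_chord_conj _ _ _ _ _ _ Hz Uz Ul Hs Hp).
  assert (HT := opposite_chord_tangent _ _ _ _ _ _ _ Hcl Hz Nz Hs Hp).
  destruct (unit_sqrt p Up) as [rho [Urho Hrho]].
  assert (Nrho := on_unit_circle_neq0 _ Urho).
  assert (Hreal : Cconj (s * Cconj rho)%C = (s * Cconj rho)%C).
  { rewrite Cmult_conj, Cconj_conj, (on_unit_circle_conj _ Urho).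
    rewrite <- Hrho in Hconj.
    apply (linear_combination1 (- / rho)%C _ _ _ _ Hconj); field; exact Nrho. }
  apply real_of_conj in Hreal.
  set (kappa := fst (s * Cconj rho)%C / 2) in *.
  assert (Hs2 : s = (2 * rho * kappa)%C).
  { unfold kappa; rewrite RtoC_div by lra; rewrite <- Hreal, (on_unit_circle_conj _ Urho).
    field; exact Nrho. }
  assert (Hk : kappa ^ 2 < 1).
  { unfold chord_tangent in HT; rewrite Hs2, <- Hrho, (tangency_normal_form _ _ _ _ _ Urho) in HT.
    apply Cmult_eq0 in HT.
    2:{ apply Cmult_neq_0; [|apply Cpow_nz, Nrho].
        intros E; apply RtoC_inj in E; lra. }
    apply RtoC_inj in HT.
    assert (Ur := proj1 (on_unit_circle_coord rho) Urho).
    replace 1 with (fst rho ^ 2 + snd rho ^ 2) by lra.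
    apply (tangent_line_meets_disc a b r kappa c rho Hb Ha Hr Hin).
    - intros E; apply Nrho; exact E.
    - apply Rminus_diag_uniq; rewrite <- HT; unfold to_unit, focal_par, axes_par; simpl fst; simpl snd.
      field; lra. }
  set (tau := sqrt (1 - kappa ^ 2)).
  assert (Htau : tau ^ 2 = 1 - kappa ^ 2) by (unfold tau; apply pow2_sqrt; lra).
  assert (Htau0 : 0 < tau) by (apply sqrt_lt_R0; lra).
  (* The missing roots are rho e and rho conj e, symmetric about the normal rho. *)
  set (e := (kappa, tau) : C).
  assert (Ue : on_unit_circle e) by (apply on_unit_circle_coord; simpl; lra).
  exists (rho * e)%C, (rho * Cconj e)%C; repeat split.
  - apply on_unit_circle_mult; assumption.
  - apply on_unit_circle_mult; [|apply on_unit_circle_Cconj]; assumption.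
  - intros E; assert (Ee : (e - Cconj e = 0)%C).
    { apply (Cmult_eq0 rho); [|exact Nrho].
      transitivity (rho * e - rho * Cconj e)%C; [ring | rewrite E; ring]. }
    apply (f_equal snd) in Ee; simpl in Ee; lra.
  - rewrite <- Hs, Hs2.
    assert (He : (e + Cconj e = 2 * kappa)%C) by (apply injective_projections; simpl; ring).
    transitivity (z + rho * (e + Cconj e))%C; [ring | rewrite He; ring].
  - rewrite <- Hp, <- Hrho; unfold on_unit_circle in Ue.
    transitivity (z * (rho ^ 2 * (e * Cconj e)))%C; [ring | rewrite Ue; ring].
Qed.

(** Given one root of the cubic, the sum and the product of the others determine the
factorization of the cubic. *)
Lemma remaining_vertex_closing_point (w l z z2 z3 : C) (k : R) :
  z <> 0%C -> closing_point w k l z ->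
  (z + (z2 + z3) = vertex_sum w k l)%C -> (z * (z2 * z3) = l)%C ->
  closing_point w k l z2.
Proof.
  rewrite !closing_point_cubic; intros Nz Hz Hs Hp.
  rewrite <- Hs, <- Hp in *.
  set (q := (w ^ 2 + k + 2 * (z * (z2 * z3)) * Cconj w)%C) in *.
  assert (Hq : (z * (z2 + z3) + z2 * z3 - q = 0)%C).
  { apply (Cmult_eq0 z); [|exact Nz].
    apply (linear_combination1 (- (1))%C _ _ _ _ Hz); ring. }
  apply (linear_combination1 (- z2)%C _ _ _ _ Hq); ring.
Qed.

(** The porism: every l of modulus one is the vertex product of a triangle of the family.
Each side is the opposite chord of a vertex, so [opposite_chord_tangent] applies three times. *)
Lemma poncelet_triangle_exists (a b r : R) (c : point) (l : C) :
  0 < b -> 0 < a -> 0 < r -> circle_inside a b c r ->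
  closure_relation (to_unit a b c) (focal_par a b r) (axes_par a b r) ->
  on_unit_circle l ->
  exists t, poncelet_triangle a b c r t /\ vertex_product a b t = l.
Proof.
  intros Hb Ha Hr Hin Hcl Ul.
  set (w := to_unit a b c) in *; set (k := focal_par a b r) in *; set (h := axes_par a b r) in *.
  destruct (closing_point_exists w l k Ul) as [z1 [U1 H1]].
  destruct (remaining_vertices_exist l z1 a b r c Hb Ha Hr Hin Hcl Ul U1 H1)
    as [z2 [z3 [U2 [U3 [N23 [Hs Hp]]]]]].
  assert (N1 := on_unit_circle_neq0 _ U1); assert (N2 := on_unit_circle_neq0 _ U2).
  assert (N3 := on_unit_circle_neq0 _ U3).
  assert (H2 := remaining_vertex_closing_point _ _ _ _ _ _ N1 H1 Hs Hp).
  assert (H3 : closing_point w k l z3).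
  { apply (remaining_vertex_closing_point w l z1 z3 z2 k N1 H1).
    - rewrite (Cplus_comm z3); exact Hs.
    - rewrite (Cmult_comm z3); exact Hp. }
  assert (T23 := opposite_chord_tangent _ _ _ _ _ _ _ Hcl H1 N1 Hs Hp).
  assert (T31 : chord_tangent w k h (z3 + z1)%C (z3 * z1)%C).
  { apply (opposite_chord_tangent w k h l z2); try assumption.
    - fold w k in Hs; rewrite <- Hs; ring.
    - rewrite <- Hp; ring. }
  assert (T12 : chord_tangent w k h (z1 + z2)%C (z1 * z2)%C).
  { apply (opposite_chord_tangent w k h l z3); try assumption.
    - fold w k in Hs; rewrite <- Hs; ring.
    - rewrite <- Hp; ring. }
  destruct (chord_tangent_side_tangent a b r c z1 z2 Hb Ha Hr Hin U1 U2 T12) as [N12 S12].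
  destruct (chord_tangent_side_tangent a b r c z2 z3 Hb Ha Hr Hin U2 U3 T23) as [_ S23].
  destruct (chord_tangent_side_tangent a b r c z3 z1 Hb Ha Hr Hin U3 U1 T31) as [N31 S31].
  exists (Triangle (of_unit a b z1) (of_unit a b z2) (of_unit a b z3)); split; [split|].
  - unfold nondegenerate, of_unit; simpl fst; simpl snd.
    assert (E := unit_triangle_cross z1 z2 z3 U1 U2 U3).
    match type of E with (_ * RtoC ?x = _)%C => set (cr := x) in E end.
    replace (_ - _) with (a * b * cr) by (unfold cr; ring).
    assert (Hcr : cr <> 0).
    { intros F; rewrite F, Cmult_0_r in E; symmetry in E; revert E.
      repeat apply Cmult_neq_0; apply Cminus_eq_contra; assumption || (apply neq_sym; assumption). }
    apply Rmult_integral_contrapositive_currified; [|exact Hcr].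
    apply Rmult_integral_contrapositive_currified; lra.
  - split; [|simpl; repeat split; assumption].
    intros P [-> | [-> | ->]]; simpl; apply on_ellipse_to_unit; try lra;
      rewrite of_unitK by lra; assumption.
  - unfold vertex_product; simpl; rewrite !of_unitK by lra; rewrite <- Hp; ring.
Qed.

(** * Circumcircles *)

(** Each hypothesis, multiplied by z^2, is a quartic with leading and constant coefficients 1,
so its fourth root is the inverse of z1 z2 z3, and m and n are elementary symmetric functions of
the four roots.  The proof takes divided differences instead of naming the fourth root. *)
Lemma reciprocal_quartic_coefficients (m n m' z1 z2 z3 : C) :
  z1 <> z2 -> z1 <> z3 -> z2 <> z3 -> z1 <> 0%C -> z2 <> 0%C -> z3 <> 0%C ->
  (z1 ^ 2 - m * z1 + n - m' / z1 + / z1 ^ 2 = 0)%C ->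
  (z2 ^ 2 - m * z2 + n - m' / z2 + / z2 ^ 2 = 0)%C ->
  (z3 ^ 2 - m * z3 + n - m' / z3 + / z3 ^ 2 = 0)%C ->
  (m = z1 + z2 + z3 + / (z1 * z2 * z3))%C /\
  (n = z1 * z2 + z1 * z3 + z2 * z3 + (z1 + z2 + z3) / (z1 * z2 * z3))%C.
Proof.
  intros N12 N13 N23 N1 N2 N3 H1 H2 H3.
  assert (H12 : (z1 ^ 2 + z1 * z2 + z2 ^ 2 - m * (z1 + z2) + n - / (z1 * z2) = 0)%C).
  { apply (Cmult_eq0 (z1 - z2)%C); [|apply Cminus_eq_contra, N12].
    apply (linear_combination2 z1 (- z2)%C _ _ _ _ _ _ H1 H2); field; split; assumption. }
  assert (H13 : (z1 ^ 2 + z1 * z3 + z3 ^ 2 - m * (z1 + z3) + n - / (z1 * z3) = 0)%C).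
  { apply (Cmult_eq0 (z1 - z3)%C); [|apply Cminus_eq_contra, N13].
    apply (linear_combination2 z1 (- z3)%C _ _ _ _ _ _ H1 H3); field; split; assumption. }
  assert (Hm : (m = z1 + z2 + z3 + / (z1 * z2 * z3))%C).
  { symmetry; apply Csub_eq0, (Cmult_eq0 (z2 - z3)%C); [|apply Cminus_eq_contra, N23].
    apply (linear_combination2 1%C (- (1))%C _ _ _ _ _ _ H12 H13); field; repeat split; assumption. }
  split; [exact Hm|].
  rewrite Hm in H12.
  apply (linear_combination1 1%C _ _ _ _ H12); field; repeat split; assumption.
Qed.

(** The center (x, y) is read off from m = 4 (a x - i b y) / (a^2 - b^2), the sum vertex_sum + conj l
of the four intersections with the ellipse in scaled coordinates. *)
Definition circumcenter_at (a b : R) (w : C) (k : R) (l : C) : point :=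
  ((a ^ 2 - b ^ 2) / (4 * a) *
     (2 * fst w + (fst w ^ 2 - snd w ^ 2 + k + 1) * fst l + 2 * fst w * snd w * snd l),
   - ((a ^ 2 - b ^ 2) / (4 * b)) *
     (2 * snd w - 2 * fst w * snd w * fst l + (fst w ^ 2 - snd w ^ 2 + k - 1) * snd l)).

(** Power of the origin with respect to the circumcircle, from the second symmetric function
of the four intersections. *)
Definition origin_power_at (a b : R) (w : C) (k : R) (l : C) : R :=
  (a ^ 2 - b ^ 2) / 2 *
    (2 * (fst w * fst l + snd w * snd l) + fst w ^ 2 - snd w ^ 2 + k)
  - (a ^ 2 + b ^ 2) / 2.

(** Substituting (a Re z, b Im z) in the equation of a circle, where p is the power of the
origin, gives a reciprocal quartic in z divided by z^2. *)
Lemma ellipse_point_on_circle (a b p : R) (z : C) (o : point) :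
  a <> 0 -> b <> 0 -> a ^ 2 - b ^ 2 <> 0 -> on_unit_circle z ->
  (a * fst z) ^ 2 + (b * snd z) ^ 2 - 2 * (a * fst z) * fst o - 2 * (b * snd z) * snd o + p = 0 ->
  let m := (4 * (a * fst o) / (a ^ 2 - b ^ 2), - (4 * (b * snd o) / (a ^ 2 - b ^ 2))) : C in
  (z ^ 2 - m * z + RtoC (4 / (a ^ 2 - b ^ 2) * ((a ^ 2 + b ^ 2) / 2 + p))
     - Cconj m / z + / z ^ 2 = 0)%C.
Proof.
  intros Ha Hb Hc U H m.
  assert (Uc := proj1 (on_unit_circle_coord z) U).
  assert (Hc' : a * a - b * b <> 0) by (intros E; apply Hc; rewrite <- E; ring).
  replace (/ z ^ 2)%C with (Cconj z ^ 2)%C.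
  2:{ rewrite (on_unit_circle_conj _ U), Cpow_inv; [reflexivity | apply on_unit_circle_neq0, U]. }
  unfold Cdiv; rewrite <- (on_unit_circle_conj _ U).
  destruct z as [x y]; simpl fst in *; simpl snd in *.
  transitivity (RtoC (4 / (a ^ 2 - b ^ 2) * 0)); [|f_equal; ring].
  rewrite <- H; unfold m.
  apply injective_projections; simpl.
  - apply Rminus_diag_uniq.
    transitivity ((2 * (a ^ 2 + b ^ 2) / (a ^ 2 - b ^ 2)) * (1 - (x * x + y * y))).
    + field; assumption.
    + rewrite Uc; ring.
  - field; assumption.
Qed.

Lemma circle_power (o P : point) (rho : R) :
  on_circle o rho P ->
  fst P ^ 2 + snd P ^ 2 - 2 * fst P * fst o - 2 * snd P * snd o
    + (fst o ^ 2 + snd o ^ 2 - rho ^ 2) = 0.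
Proof.
  unfold on_circle; intros <-; rewrite pdist_sq; ring.
Qed.

Lemma poncelet_circumcircle (a b r rho : R) (c o : point) (t : plane_triangle) :
  0 < b -> b < a -> poncelet_relations a b c r t -> is_circumcircle t o rho ->
  o = circumcenter_at a b (to_unit a b c) (focal_par a b r) (vertex_product a b t) /\
  fst o ^ 2 + snd o ^ 2 - rho ^ 2
    = origin_power_at a b (to_unit a b c) (focal_par a b r) (vertex_product a b t).
Proof.
  intros Hb Hab Hrel Hcirc.
  destruct (poncelet_vertex_sum _ _ _ _ _ Hrel) as [Hsum _].
  destruct Hrel as [UA UB UC NAB NAC NBC _ _ _].
  assert (Hc : a ^ 2 - b ^ 2 <> 0) by nra.
  assert (Hc' : a * a - b * b <> 0) by nra.
  set (m := (4 * (a * fst o) / (a ^ 2 - b ^ 2), - (4 * (b * snd o) / (a ^ 2 - b ^ 2))) : C).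
  set (p := fst o ^ 2 + snd o ^ 2 - rho ^ 2) in *.
  set (n := RtoC (4 / (a ^ 2 - b ^ 2) * ((a ^ 2 + b ^ 2) / 2 + p))).
  assert (Q : forall P, is_vertex t P -> on_unit_circle (to_unit a b P) ->
    (to_unit a b P ^ 2 - m * to_unit a b P + n - Cconj m / to_unit a b P
      + / to_unit a b P ^ 2 = 0)%C).
  { intros P HP U.
    apply (ellipse_point_on_circle a b p (to_unit a b P) o); [lra | lra | exact Hc | exact U |].
    rewrite <- (circle_power o P rho (Hcirc P HP)).
    unfold to_unit, p; simpl fst; simpl snd; field; lra. }
  set (z1 := to_unit a b (vA t)) in *; set (z2 := to_unit a b (vB t)) in *;
    set (z3 := to_unit a b (vC t)) in *.
  assert (Q1 := Q (vA t) (or_introl eq_refl) UA).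
  assert (Q2 := Q (vB t) (or_intror (or_introl eq_refl)) UB).
  assert (Q3 := Q (vC t) (or_intror (or_intror eq_refl)) UC).
  fold z1 in Q1; fold z2 in Q2; fold z3 in Q3.
  assert (N1 := on_unit_circle_neq0 _ UA); assert (N2 := on_unit_circle_neq0 _ UB).
  assert (N3 := on_unit_circle_neq0 _ UC).
  destruct (reciprocal_quartic_coefficients m n (Cconj m) z1 z2 z3 NAB NAC NBC N1 N2 N3 Q1 Q2 Q3)
    as [Hm Hn].
  assert (Hl : vertex_product a b t = (z1 * z2 * z3)%C) by reflexivity.
  rewrite Hl in *; set (l := (z1 * z2 * z3)%C) in *.
  assert (Ul : on_unit_circle l) by (repeat apply on_unit_circle_mult; assumption).
  assert (Nl := on_unit_circle_neq0 _ Ul).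
  assert (Hn' : n = (l * Cconj (z1 + z2 + z3) + (z1 + z2 + z3) * Cconj l)%C).
  { rewrite Hn, !Cplus_conj, !on_unit_circle_conj by assumption.
    unfold l; field; repeat split; assumption. }
  rewrite Hsum in Hm, Hn'; rewrite <- (on_unit_circle_conj _ Ul) in Hm.
  set (w := to_unit a b c) in *; set (k := focal_par a b r) in *.
  assert (Ulc := proj1 (on_unit_circle_coord l) Ul).
  clearbody l w k.
  destruct l as [l1 l2], w as [X Y], o as [o1 o2].
  unfold circumcenter_at, origin_power_at.
  assert (Hm1 := f_equal fst Hm); assert (Hm2 := f_equal snd Hm); assert (Hn1 := f_equal fst Hn').
  unfold m, n, vertex_sum in Hm1, Hm2, Hn1; clear - Hm1 Hm2 Hn1 Hb Hab Hc Hc' Ulc.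
  simpl in Hm1, Hm2, Hn1, Ulc |- *.
  split; [apply injective_projections; simpl|].
  - transitivity ((a ^ 2 - b ^ 2) / (4 * a) * (4 * (a * o1) / (a * (a * 1) - b * (b * 1)))).
    + field; split; assumption || lra.
    + rewrite Hm1; field; lra.
  - transitivity (- ((a ^ 2 - b ^ 2) / (4 * b)) * (- (4 * (b * o2) / (a * (a * 1) - b * (b * 1))))).
    + field; split; assumption || lra.
    + rewrite Hm2; field; lra.
  - transitivity ((a ^ 2 - b ^ 2) / 4 *
      (4 / (a * (a * 1) - b * (b * 1)) * ((a * (a * 1) + b * (b * 1)) / 2 + p)) - (a ^ 2 + b ^ 2) / 2).
    + field; assumption.
    + rewrite Hn1.
      apply Rminus_diag_uniq.
      transitivity ((a ^ 2 - b ^ 2) / 2 * (X ^ 2 - Y ^ 2 + k) * ((l1 * l1 + l2 * l2) - 1)).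
      * field.
      * rewrite Ulc; ring.
Qed.

Lemma circumcircle_exists (t : plane_triangle) :
  nondegenerate t -> exists o rho, is_circumcircle t o rho.
Proof.
  destruct t as [[x1 y1] [x2 y2] [x3 y3]]; unfold nondegenerate; simpl; intros Hnd.
  set (D := (x2 - x1) * (y3 - y1) - (y2 - y1) * (x3 - x1)) in *.
  set (d2 := (x2 - x1) ^ 2 + (y2 - y1) ^ 2); set (d3 := (x3 - x1) ^ 2 + (y3 - y1) ^ 2).
  set (e := (d2 * (y3 - y1) - d3 * (y2 - y1)) / (2 * D)).
  set (f := (d3 * (x2 - x1) - d2 * (x3 - x1)) / (2 * D)).
  assert (E2 : 2 * (e * (x2 - x1) + f * (y2 - y1)) = d2) by (unfold e, f, D; field; exact Hnd).
  assert (E3 : 2 * (e * (x3 - x1) + f * (y3 - y1)) = d3) by (unfold e, f, D; field; exact Hnd).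
  exists (x1 + e, y1 + f), (pdist (x1, y1) (x1 + e, y1 + f)).
  assert (Hv : forall x y, (x - x1) ^ 2 + (y - y1) ^ 2 = 2 * (e * (x - x1) + f * (y - y1)) ->
    on_circle (x1 + e, y1 + f) (pdist (x1, y1) (x1 + e, y1 + f)) (x, y)).
  { intros x y H; apply on_circle_sq; [apply pdist_ge0|]; rewrite pdist_sq; simpl fst; simpl snd.
    apply Rminus_diag_uniq; apply Rminus_diag_eq in H; rewrite <- H; ring. }
  intros P [-> | [-> | ->]]; simpl.
  - reflexivity.
  - apply Hv; symmetry; exact E2.
  - apply Hv; symmetry; exact E3.
Qed.

(** * The parameter moves with nonzero velocity *)

Definition is_cderive (f : R -> C) (u : R) (v : C) : Prop :=
  is_derive (fun x => fst (f x)) u (fst v) /\ is_derive (fun x => snd (f x)) u (snd v).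

Lemma is_cderive_plus (f g : R -> C) (u : R) (v w : C) :
  is_cderive f u v -> is_cderive g u w -> is_cderive (fun x => f x + g x)%C u (v + w)%C.
Proof.
  intros [F1 F2] [G1 G2]; split; simpl; apply (is_derive_plus (V := R_NormedModule)); assumption.
Qed.

Lemma is_derive_Rmult (f g : R -> R) (u v w : R) :
  is_derive f u v -> is_derive g u w -> is_derive (fun x => f x * g x) u (v * g u + f u * w).
Proof.
  intros F G; apply (is_derive_mult f g u v w F G); intros; apply Rmult_comm.
Qed.

Lemma is_cderive_mult (f g : R -> C) (u : R) (v w : C) :
  is_cderive f u v -> is_cderive g u w ->
  is_cderive (fun x => f x * g x)%C u (v * g u + f u * w)%C.
Proof.
  intros [F1 F2] [G1 G2]; split; simpl.
  - replace (_ - _ + _) with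
      ((fst v * fst (g u) + fst (f u) * fst w) - (snd v * snd (g u) + snd (f u) * snd w)) by ring.
    apply (is_derive_minus (V := R_NormedModule));
      apply is_derive_Rmult; assumption.
  - replace (fst v * snd (g u) + snd v * fst (g u) + (fst (f u) * snd w + snd (f u) * fst w)) with
      ((fst v * snd (g u) + fst (f u) * snd w) + (snd v * fst (g u) + snd (f u) * fst w)) by ring.
    apply (is_derive_plus (V := R_NormedModule));
      apply is_derive_Rmult; assumption.
Qed.

Lemma is_cderive_conj (f : R -> C) (u : R) (v : C) :
  is_cderive f u v -> is_cderive (fun x => Cconj (f x)) u (Cconj v).
Proof.
  intros [F1 F2]; split; simpl; [exact F1|].
  apply (is_derive_opp (V := R_NormedModule)); exact F2.
Qed.

Lemma is_cderive_const (c : C) (u : R) : is_cderive (fun _ => c) u 0%C.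
Proof. split; simpl; apply (is_derive_const (V := R_NormedModule)). Qed.

Lemma is_cderive_unique (f g : R -> C) (u : R) (v w : C) :
  (forall x, f x = g x) -> is_cderive f u v -> is_cderive g u w -> v = w.
Proof.
  intros E [F1 F2] [G1 G2]; apply injective_projections.
  - rewrite <- (is_derive_unique _ _ _ F1), <- (is_derive_unique _ _ _ G1).
    apply Derive_ext; intros x; rewrite E; reflexivity.
  - rewrite <- (is_derive_unique _ _ _ F2), <- (is_derive_unique _ _ _ G2).
    apply Derive_ext; intros x; rewrite E; reflexivity.
Qed.

(** Differentiate z conj z = 1. *)
Lemma unit_curve_velocity (z : R -> C) (u : R) (v : C) :
  (forall x, on_unit_circle (z x)) -> is_cderive z u v -> (Cconj v = - (v / z u ^ 2))%C.
Proof.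
  intros U H.
  assert (E := is_cderive_unique _ _ _ _ _ U
    (is_cderive_mult _ _ _ _ _ H (is_cderive_conj _ _ _ H)) (is_cderive_const 1%C u)); cbv beta in E.
  rewrite (on_unit_circle_conj _ (U u)) in E.
  assert (N := on_unit_circle_neq0 _ (U u)).
  apply (linear_combination1 (/ z u)%C _ _ _ _ E); field; exact N.
Qed.

(** If the product stops, then with y_j = v_j / z_j the sums of y_j, z_j y_j and y_j / z_j all
vanish: the first is the logarithmic derivative of the product, the second the derivative of
the sum, the third its conjugate.  This Vandermonde system has only the zero solution. *)
Lemma product_velocity_neq0 (z1 z2 z3 : R -> C) (c0 c1 v1 v2 v3 : C) (u : R) :
  (forall x, on_unit_circle (z1 x)) -> (forall x, on_unit_circle (z2 x)) ->
  (forall x, on_unit_circle (z3 x)) ->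
  z1 u <> z2 u -> z1 u <> z3 u ->
  (forall x, z1 x + z2 x + z3 x = c0 + c1 * (z1 x * z2 x * z3 x))%C ->
  is_cderive z1 u v1 -> is_cderive z2 u v2 -> is_cderive z3 u v3 -> v1 <> 0%C ->
  exists v, is_cderive (fun x => z1 x * z2 x * z3 x)%C u v /\ v <> 0%C.
Proof.
  intros U1 U2 U3 N12 N13 Hsum D1 D2 D3 Nv.
  assert (DP := is_cderive_mult _ _ _ _ _ (is_cderive_mult _ _ _ _ _ D1 D2) D3).
  eexists; split; [exact DP|]; intros HP; cbv beta in HP.
  assert (DS := is_cderive_plus _ _ _ _ _ (is_cderive_plus _ _ _ _ _ D1 D2) D3).
  assert (DR := is_cderive_plus _ _ _ _ _ (is_cderive_const c0 u)
    (is_cderive_mult _ _ _ _ _ (is_cderive_const c1 u) DP)).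
  assert (HS := is_cderive_unique _ _ _ _ _ Hsum DS DR); cbv beta in HS.
  rewrite HP in HS.
  assert (HS0 : (v1 + v2 + v3 = 0)%C) by (rewrite HS; ring).
  assert (HC := f_equal Cconj HS0).
  rewrite !Cplus_conj, RtoC_conj, (unit_curve_velocity _ _ _ U1 D1),
    (unit_curve_velocity _ _ _ U2 D2), (unit_curve_velocity _ _ _ U3 D3) in HC.
  assert (M1 := on_unit_circle_neq0 _ (U1 u)); assert (M2 := on_unit_circle_neq0 _ (U2 u)).
  assert (M3 := on_unit_circle_neq0 _ (U3 u)).
  apply Nv, (Cmult_eq0 ((z1 u - z2 u) * (z1 u - z3 u) / z1 u ^ 2)%C).
  - apply (linear_combination3 1%C (- (z2 u + z3 u) / (z1 u * z2 u * z3 u))%C (- (z2 u * z3 u))%C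
      _ _ _ _ _ _ _ _ HS0 HP HC); field; repeat split; assumption.
  - unfold Cdiv; repeat apply Cmult_neq_0; try (apply Cminus_eq_contra; assumption).
    intros E; assert (F := Cinv_r (z1 u ^ 2)%C (Cpow_nz _ 2 M1)); rewrite E, Cmult_0_r in F.
    apply RtoC_inj in F; lra.
Qed.

Lemma to_unit_velocity (a b : R) (g : R -> point) (u : R) (v : R * R) :
  a <> 0 -> b <> 0 ->
  is_derive (fun x => fst (g x)) u (fst v) -> is_derive (fun x => snd (g x)) u (snd v) ->
  is_cderive (fun x => to_unit a b (g x)) u (to_unit a b v).
Proof.
  intros Ha Hb H1 H2; split; simpl; unfold Rdiv.
  - replace (fst v * / a) with (fst v * / a + fst (g u) * 0) by ring.
    apply (is_derive_Rmult (fun x => fst (g x)) (fun _ => / a)); [exact H1 | apply (is_derive_const (V := R_NormedModule))].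
  - replace (snd v * / b) with (snd v * / b + snd (g u) * 0) by ring.
    apply (is_derive_Rmult (fun x => snd (g x)) (fun _ => / b)); [exact H2 | apply (is_derive_const (V := R_NormedModule))].
Qed.

(** Regularity of the vertex curves passes to the parameter l of the circle family, which is
why the condition dK/du = 0 may be read as stationarity in l. *)
Lemma vertex_product_velocity (a b r : R) (c : point) (T : R -> plane_triangle) (u : R) :
  0 < b -> 0 < a -> (forall x, poncelet_relations a b c r (T x)) ->
  regular_curve (fun x => vA (T x)) -> regular_curve (fun x => vB (T x)) ->
  regular_curve (fun x => vC (T x)) ->
  exists v, is_cderive (fun x => vertex_product a b (T x)) u v /\ v <> 0%C.
Proof.
  intros Hb Ha Hrel RA RB RC.
  destruct (RA u) as [vA0 [NA [A1 A2]]]; destruct (RB u) as [vB0 [_ [B1 B2]]];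
    destruct (RC u) as [vC0 [_ [C1 C2]]].
  assert (Ha0 : a <> 0) by lra; assert (Hb0 : b <> 0) by lra.
  apply (product_velocity_neq0 _ _ _ (2 * to_unit a b c)%C (Cconj (to_unit a b c) ^ 2 + focal_par a b r)%C
    (to_unit a b vA0) (to_unit a b vB0) (to_unit a b vC0)).
  - intros x; apply (Hrel x).
  - intros x; apply (Hrel x).
  - intros x; apply (Hrel x).
  - apply (Hrel u).
  - apply (Hrel u).
  - intros x; rewrite (proj1 (poncelet_vertex_sum _ _ _ _ _ (Hrel x))).
    unfold vertex_sum, vertex_product; ring.
  - apply to_unit_velocity; assumption.
  - apply to_unit_velocity; assumption.
  - apply to_unit_velocity; assumption.
  - intros E; apply NA, (to_unit_inj a b); [exact Ha0 | exact Hb0|]; rewrite E.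
    apply injective_projections; simpl; field; assumption.
Qed.

Lemma unit_curve_orthogonal (z : R -> C) (u : R) (v : C) :
  (forall x, on_unit_circle (z x)) -> is_cderive z u v ->
  fst (z u) * fst v + snd (z u) * snd v = 0.
Proof.
  intros U D.
  assert (F := is_cderive_unique _ _ _ _ _ U
    (is_cderive_mult _ _ _ _ _ D (is_cderive_conj _ _ _ D)) (is_cderive_const 1%C u)).
  apply (f_equal fst) in F; simpl in F; lra.
Qed.

Lemma is_derive_affine (f g : R -> R) (A B E u v w : R) :
  is_derive f u v -> is_derive g u w ->
  is_derive (fun x => A + B * f x + E * g x) u (B * v + E * w).
Proof.
  intros F G.
  apply (is_derive_plus (V := R_NormedModule) (fun x => A + B * f x) (fun x => E * g x));
    [|apply is_derive_scal, G].
  replace (B * v) with (0 + B * v) by ring.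
  apply (is_derive_plus (V := R_NormedModule) (fun _ => A) (fun x => B * f x));
    [apply (is_derive_const (V := R_NormedModule)) | apply is_derive_scal, F].
Qed.

(** * The discriminant of the circle family *)

(** A linear form stationary at a point of the unit circle has there, up to sign, its norm as
value. *)
Lemma stationary_on_circle (A B E l1 l2 v1 v2 : R) :
  l1 * l1 + l2 * l2 = 1 -> l1 * v1 + l2 * v2 = 0 -> (v1, v2) <> (0, 0) ->
  A + B * l1 + E * l2 = 0 -> B * v1 + E * v2 = 0 -> A ^ 2 = B ^ 2 + E ^ 2.
Proof.
  intros Hl Ht Hv HA HD.
  (* The velocity is tangent to the unit circle, so it equals s times (- l2, l1). *)
  set (s := l1 * v2 - l2 * v1).
  assert (E1 : v1 = - l2 * s).
  { unfold s; replace v1 with (v1 * (l1 * l1 + l2 * l2)) at 1 by (rewrite Hl; ring).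
    apply Rminus_diag_uniq; transitivity (l1 * (l1 * v1 + l2 * v2)); [ring | rewrite Ht; ring]. }
  assert (E2 : v2 = l1 * s).
  { unfold s; replace v2 with (v2 * (l1 * l1 + l2 * l2)) at 1 by (rewrite Hl; ring).
    apply Rminus_diag_uniq; transitivity (l2 * (l1 * v1 + l2 * v2)); [ring | rewrite Ht; ring]. }
  assert (Hs : s <> 0).
  { intros F; apply Hv; rewrite E1, E2, F; f_equal; ring. }
  assert (H0 : E * l1 - B * l2 = 0).
  { apply (Rmult_eq_reg_r s); [|exact Hs]; rewrite E1, E2 in HD; lra. }
  replace A with (- (B * l1 + E * l2)) by lra.
  transitivity ((B ^ 2 + E ^ 2) * (l1 * l1 + l2 * l2) - (E * l1 - B * l2) ^ 2).
  - ring.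
  - rewrite H0, Hl; ring.
Qed.

Lemma stationary_parameter_exists (A B E : R) :
  A ^ 2 = B ^ 2 + E ^ 2 ->
  exists l1 l2, l1 * l1 + l2 * l2 = 1 /\ A + B * l1 + E * l2 = 0 /\ E * l1 - B * l2 = 0.
Proof.
  intros H; destruct (Req_dec A 0) as [->|HA].
  - replace (0 ^ 2) with 0 in H by ring; symmetry in H; apply sum_sq_eq0 in H.
    destruct H as [-> ->]; exists 1, 0; repeat split; ring.
  - exists (- B / A), (- E / A); repeat split.
    + transitivity ((B ^ 2 + E ^ 2) / A ^ 2); [field; exact HA | rewrite <- H; field; exact HA].
    + transitivity ((A ^ 2 - (B ^ 2 + E ^ 2)) / A); [field; exact HA | rewrite H; field; exact HA].
    + field; exact HA.
Qed.

(** The equation of the circumcircle at P is affine in l; [circle_const], [circle_cos] and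
[circle_sin] are its coefficients. *)
Definition circle_const (a b : R) (w : C) (k : R) (P : point) : R :=
  fst P ^ 2 + snd P ^ 2 - fst P * ((a ^ 2 - b ^ 2) / a * fst w) + snd P * ((a ^ 2 - b ^ 2) / b * snd w)
  - (a ^ 2 + b ^ 2) / 2 + (a ^ 2 - b ^ 2) / 2 * (fst w ^ 2 - snd w ^ 2 + k).

Definition circle_cos (a b : R) (w : C) (k : R) (P : point) : R :=
  - fst P * ((a ^ 2 - b ^ 2) / (2 * a) * (fst w ^ 2 - snd w ^ 2 + k + 1))
  - snd P * ((a ^ 2 - b ^ 2) / b * (fst w * snd w)) + (a ^ 2 - b ^ 2) * fst w.

Definition circle_sin (a b : R) (w : C) (k : R) (P : point) : R :=
  - fst P * ((a ^ 2 - b ^ 2) / a * (fst w * snd w))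
  + snd P * ((a ^ 2 - b ^ 2) / (2 * b) * (fst w ^ 2 - snd w ^ 2 + k - 1)) + (a ^ 2 - b ^ 2) * snd w.

Lemma circle_family_affine (a b : R) (w : C) (k : R) (l : C) (P : point) :
  a <> 0 -> b <> 0 ->
  fst P ^ 2 + snd P ^ 2 - 2 * fst P * fst (circumcenter_at a b w k l)
    - 2 * snd P * snd (circumcenter_at a b w k l) + origin_power_at a b w k l
  = circle_const a b w k P + circle_cos a b w k P * fst l + circle_sin a b w k P * snd l.
Proof.
  intros Ha Hb; unfold circumcenter_at, origin_power_at, circle_const, circle_cos, circle_sin.
  simpl fst; simpl snd; field; split; assumption.
Qed.

(** Equation of the circle centered at (c^2 X / a, 0), with c^2 = a^2 - b^2, that for |X| < 1
touches the ellipse at its two points of abscissa a X. *)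
Definition inner_equation (a b X : R) (P : point) : R :=
  (fst P - (a ^ 2 - b ^ 2) / a * X) ^ 2 + snd P ^ 2 - b ^ 2 * (1 - (a ^ 2 - b ^ 2) / a ^ 2 * X ^ 2).

(** Equation of the circle centered at (0, - c^2 Y / b), with c^2 = a^2 - b^2, that for |Y| < 1
touches the ellipse at its two points of ordinate b Y. *)
Definition outer_equation (a b Y : R) (P : point) : R :=
  fst P ^ 2 + (snd P + (a ^ 2 - b ^ 2) / b * Y) ^ 2 - a ^ 2 * (1 + (a ^ 2 - b ^ 2) / b ^ 2 * Y ^ 2).

Lemma closure_relation_real (w : C) (k h : R) :
  closure_relation w k h ->
  2 * h = 1 - 2 * (fst w ^ 2 + snd w ^ 2) + (fst w ^ 2 - snd w ^ 2 + k) ^ 2 + 4 * fst w ^ 2 * snd w ^ 2.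
Proof.
  intros H; apply (f_equal fst) in H; simpl in H; lra.
Qed.

(** Both sides are quartics in P with the same leading part, and their difference is,
up to a constant, the equation of the ellipse times the defect of the closure relation. *)
Lemma discriminant_factors (a b r : R) (w : C) (P : point) :
  a <> 0 -> b <> 0 ->
  closure_relation w (focal_par a b r) (axes_par a b r) ->
  circle_const a b w (focal_par a b r) P ^ 2
    - (circle_cos a b w (focal_par a b r) P ^ 2 + circle_sin a b w (focal_par a b r) P ^ 2)
  = inner_equation a b (fst w) P * outer_equation a b (snd w) P.
Proof.
  intros Ha Hb H; apply closure_relation_real in H.
  set (cl := 1 - 2 * (fst w ^ 2 + snd w ^ 2) + (fst w ^ 2 - snd w ^ 2 + focal_par a b r) ^ 2
    + 4 * fst w ^ 2 * snd w ^ 2 - 2 * axes_par a b r).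
  assert (Hcl : cl = 0) by (unfold cl; lra).
  apply Rminus_diag_uniq.
  (* The cofactor of the closure defect was read off from the coefficients of x^2, y^2 and 1. *)
  transitivity ((a ^ 2 - b ^ 2) ^ 2 / 4 * (1 - fst P ^ 2 / a ^ 2 - snd P ^ 2 / b ^ 2) * cl).
  - unfold cl, circle_const, circle_cos, circle_sin, inner_equation, outer_equation, focal_par, axes_par.
    field; split; assumption.
  - rewrite Hcl; ring.
Qed.

(** * The locus of the circumcenter *)

(** In coordinates u centered between the foci, with foci +- v, this is the quadratic equation
of the ellipse with semimajor axis al.  From it the focal distances are al -+ (u.v) / al. *)
Lemma focal_sum_equation (F F' P : point) (al : R) :
  let v1 := (fst F - fst F') / 2 in let v2 := (snd F - snd F') / 2 in
  let u1 := fst P - (fst F + fst F') / 2 in let u2 := snd P - (snd F + snd F') / 2 in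
  0 < al -> v1 ^ 2 + v2 ^ 2 < al ^ 2 ->
  pdist P F + pdist P F' = 2 * al <->
  al ^ 2 * (u1 ^ 2 + u2 ^ 2) - (u1 * v1 + u2 * v2) ^ 2 = al ^ 2 * (al ^ 2 - (v1 ^ 2 + v2 ^ 2)).
Proof.
  intros v1 v2 u1 u2 Hal Hv.
  assert (D1 : pdist P F ^ 2 = u1 ^ 2 + u2 ^ 2 - 2 * (u1 * v1 + u2 * v2) + (v1 ^ 2 + v2 ^ 2))
    by (rewrite pdist_sq; unfold u1, u2, v1, v2; field).
  assert (D2 : pdist P F' ^ 2 = u1 ^ 2 + u2 ^ 2 + 2 * (u1 * v1 + u2 * v2) + (v1 ^ 2 + v2 ^ 2))
    by (rewrite pdist_sq; unfold u1, u2, v1, v2; field).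
  assert (P1 := pdist_ge0 P F); assert (P2 := pdist_ge0 P F').
  set (d1 := pdist P F) in *; set (d2 := pdist P F') in *.
  set (s := u1 * v1 + u2 * v2) in *; set (U := u1 ^ 2 + u2 ^ 2) in *; set (V := v1 ^ 2 + v2 ^ 2) in *.
  assert (Hs : s ^ 2 <= U * V).
  { assert (0 <= (u1 * v2 - u2 * v1) ^ 2) by apply pow2_ge_0.
    replace (s ^ 2) with (U * V - (u1 * v2 - u2 * v1) ^ 2) by (unfold s, U, V; ring); lra. }
  assert (HU0 : 0 <= U) by (unfold U; assert (0 <= u1 ^ 2) by apply pow2_ge_0;
    assert (0 <= u2 ^ 2) by apply pow2_ge_0; lra).
  assert (HV0 : 0 <= V) by (unfold V; assert (0 <= v1 ^ 2) by apply pow2_ge_0;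
    assert (0 <= v2 ^ 2) by apply pow2_ge_0; lra).
  split.
  - intros H.
    assert (E2 : d2 = 2 * al - d1) by lra.
    assert (E1 : al * d1 = al ^ 2 - s).
    { rewrite E2 in D2; nra. }
    assert (E3 : (al * d1) ^ 2 = al ^ 2 * (U - 2 * s + V)) by (rewrite <- D1; ring).
    rewrite E1 in E3; lra.
  - intros H.
    assert (Hlt : 0 < al ^ 2 - V) by lra.
    assert (HU : U <= al ^ 2).
    { apply (Rmult_le_reg_r (al ^ 2 - V)); [exact Hlt|]; lra. }
    assert (Hs2 : s ^ 2 <= (al ^ 2) ^ 2).
    { apply (Rle_trans _ (U * V)); [exact Hs|].
      replace ((al ^ 2) ^ 2) with (al ^ 2 * al ^ 2) by ring.
      apply Rmult_le_compat; lra. }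
    assert (Hal2 : 0 <= al ^ 2) by apply pow2_ge_0.
    assert (Habs : - al ^ 2 <= s <= al ^ 2) by (split; nra).
    assert (E1 : al * d1 = al ^ 2 - s).
    { apply pow2_inj_nonneg; [apply Rmult_le_pos; lra | lra |].
      transitivity (al ^ 2 * d1 ^ 2); [ring|]; rewrite D1; lra. }
    assert (E2 : al * d2 = al ^ 2 + s).
    { apply pow2_inj_nonneg; [apply Rmult_le_pos; lra | lra |].
      transitivity (al ^ 2 * d2 ^ 2); [ring|]; rewrite D2; lra. }
    apply (Rmult_eq_reg_l al); [lra | lra].
Qed.

(** A matrix M maps the unit circle onto the ellipse with quadratic form the inverse of M M^T.
When M M^T = be2 Id + v v^T, the adjugate turns this form into the focal equation of
[focal_sum_equation] with foci +- v and al^2 = be2 + |v|^2. *)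
Lemma linear_image_of_circle (m11 m12 m21 m22 v1 v2 u1 u2 be2 : R) :
  0 < be2 ->
  m11 ^ 2 + m12 ^ 2 = be2 + v1 ^ 2 -> m21 ^ 2 + m22 ^ 2 = be2 + v2 ^ 2 ->
  m11 * m21 + m12 * m22 = v1 * v2 ->
  (exists l1 l2, l1 * l1 + l2 * l2 = 1 /\ u1 = m11 * l1 + m12 * l2 /\ u2 = m21 * l1 + m22 * l2) <->
  (be2 + (v1 ^ 2 + v2 ^ 2)) * (u1 ^ 2 + u2 ^ 2) - (u1 * v1 + u2 * v2) ^ 2
    = (be2 + (v1 ^ 2 + v2 ^ 2)) * be2.
Proof.
  intros Hbe H1 H2 H3.
  set (d := m11 * m22 - m12 * m21).
  assert (Hd : d ^ 2 = (be2 + (v1 ^ 2 + v2 ^ 2)) * be2).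
  { transitivity ((m11 ^ 2 + m12 ^ 2) * (m21 ^ 2 + m22 ^ 2) - (m11 * m21 + m12 * m22) ^ 2);
      [unfold d; ring | rewrite H1, H2, H3; ring]. }
  assert (Hd0 : d <> 0).
  { intros E; rewrite E in Hd.
    assert (0 <= v1 ^ 2) by apply pow2_ge_0; assert (0 <= v2 ^ 2) by apply pow2_ge_0.
    assert (0 < (be2 + (v1 ^ 2 + v2 ^ 2)) * be2) by (apply Rmult_lt_0_compat; lra).
    lra. }
  rewrite <- Hd.
  assert (Hadj : (be2 + (v1 ^ 2 + v2 ^ 2)) * (u1 ^ 2 + u2 ^ 2) - (u1 * v1 + u2 * v2) ^ 2
    = (m22 * u1 - m12 * u2) ^ 2 + (m11 * u2 - m21 * u1) ^ 2).
  { transitivity ((be2 + v2 ^ 2) * u1 ^ 2 - 2 * (v1 * v2) * (u1 * u2) + (be2 + v1 ^ 2) * u2 ^ 2);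
      [ring | rewrite <- H1, <- H2, <- H3; ring]. }
  rewrite Hadj; split.
  - intros [l1 [l2 [Hl [-> ->]]]].
    transitivity (d ^ 2 * (l1 * l1 + l2 * l2)); [unfold d; ring | rewrite Hl; ring].
  - intros H; exists ((m22 * u1 - m12 * u2) / d), ((m11 * u2 - m21 * u1) / d); repeat split.
    + transitivity (((m22 * u1 - m12 * u2) ^ 2 + (m11 * u2 - m21 * u1) ^ 2) / d ^ 2);
        [field; exact Hd0 | rewrite H; field; exact Hd0].
    + unfold d; field; exact Hd0.
    + unfold d; field; exact Hd0.
Qed.

Definition inner_center (a b xc : R) : point := (xc * (1 - (b / a) ^ 2), 0).
Definition outer_center (a b yc : R) : point := (0, yc * (1 - (a / b) ^ 2)).

(** The circumcenter is an affine function of l whose linear part M satisfies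
M M^T = be2 Id + v v^T with v half the vector between the two foci; off the diagonal this is
an identity, on the diagonal it is the closure relation. *)
Lemma circumcenter_locus_conic (a b xc yc r : R) :
  0 < b -> b < a -> 0 < r -> circle_inside a b (xc, yc) r ->
  closure_relation (to_unit a b (xc, yc)) (focal_par a b r) (axes_par a b r) ->
  conic_with_foci (circumcenter_locus (poncelet_triangle a b (xc, yc) r))
    (inner_center a b xc) (outer_center a b yc).
Proof.
  intros Hb Hab Hr Hin Hcl.
  assert (Ha : 0 < a) by lra.
  assert (Hc : 0 < a ^ 2 - b ^ 2) by nra.
  assert (Hlocus : forall X, circumcenter_locus (poncelet_triangle a b (xc, yc) r) X <->
    exists l1 l2 : R, l1 * l1 + l2 * l2 = 1 /\
      X = circumcenter_at a b (to_unit a b (xc, yc)) (focal_par a b r) (l1, l2)).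
  { intros X; split.
    - intros [t [rho [Ht Hcirc]]].
      assert (Hrel := poncelet_triangle_relations a b r (xc, yc) t Hb Ha Hr Ht).
      destruct (poncelet_circumcircle _ _ _ _ _ _ _ Hb Hab Hrel Hcirc) as [-> _].
      exists (fst (vertex_product a b t)), (snd (vertex_product a b t)); split.
      + apply on_unit_circle_coord; destruct Hrel; repeat apply on_unit_circle_mult; assumption.
      + destruct (vertex_product a b t); reflexivity.
    - intros [l1 [l2 [Hl ->]]].
      destruct (poncelet_triangle_exists a b r (xc, yc) (l1, l2) Hb Ha Hr Hin Hcl) as [t [Ht Hprod]].
      { apply on_unit_circle_coord; exact Hl. }
      destruct (circumcircle_exists t (proj1 Ht)) as [o [rho Hcirc]].
      assert (Hrel := poncelet_triangle_relations a b r (xc, yc) t Hb Ha Hr Ht).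
      destruct (poncelet_circumcircle _ _ _ _ _ _ _ Hb Hab Hrel Hcirc) as [Ho _].
      exists t, rho; split; [exact Ht|]; rewrite <- Hprod, <- Ho; exact Hcirc. }
  apply closure_relation_real in Hcl.
  set (F := inner_center a b xc) in *; set (F' := outer_center a b yc) in *.
  set (k := focal_par a b r) in *.
  set (v1 := (fst F - fst F') / 2); set (v2 := (snd F - snd F') / 2).
  set (be2 := (a ^ 2 - b ^ 2) * k / 4).
  assert (Hbe : 0 < be2).
  { unfold be2; assert (0 < (a ^ 2 - b ^ 2) * k); [|lra].
    apply Rmult_lt_0_compat; [exact Hc | apply focal_par_gt0; assumption]. }
  assert (0 <= v1 ^ 2) by apply pow2_ge_0; assert (0 <= v2 ^ 2) by apply pow2_ge_0.
  set (al := sqrt (be2 + (v1 ^ 2 + v2 ^ 2))).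
  assert (Hal : 0 < al) by (apply sqrt_lt_R0; lra).
  assert (Hal2 : al ^ 2 = be2 + (v1 ^ 2 + v2 ^ 2)) by (apply pow2_sqrt; lra).
  set (X := xc / a) in *; set (Y := yc / b) in *.
  assert (Hh : axes_par a b r = k * (a ^ 2 + b ^ 2) / (a ^ 2 - b ^ 2))
    by (unfold k, axes_par, focal_par; field; repeat split; lra).
  rewrite Hh in Hcl.
  set (m11 := (a ^ 2 - b ^ 2) / (4 * a) * (X ^ 2 - Y ^ 2 + k + 1)).
  set (m12 := (a ^ 2 - b ^ 2) / (4 * a) * (2 * X * Y)).
  set (m21 := (a ^ 2 - b ^ 2) / (4 * b) * (2 * X * Y)).
  set (m22 := - ((a ^ 2 - b ^ 2) / (4 * b)) * (X ^ 2 - Y ^ 2 + k - 1)).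
  assert (Ev1 : v1 = (a ^ 2 - b ^ 2) / (2 * a) * X)
    by (unfold v1, F, F', inner_center, outer_center, X; simpl; field; lra).
  assert (Ev2 : v2 = (a ^ 2 - b ^ 2) / (2 * b) * Y)
    by (unfold v2, F, F', inner_center, outer_center, Y; simpl; field; lra).
  set (cl := 1 - 2 * (X ^ 2 + Y ^ 2) + (X ^ 2 - Y ^ 2 + k) ^ 2 + 4 * X ^ 2 * Y ^ 2
    - 2 * (k * (a ^ 2 + b ^ 2) / (a ^ 2 - b ^ 2))).
  assert (Hcl0 : cl = 0).
  { change (fst (to_unit a b (xc, yc))) with X in Hcl.
    change (snd (to_unit a b (xc, yc))) with Y in Hcl; unfold cl; lra. }
  exists (2 * al); left; split.
  - apply Rsqr_incrst_0; [|apply pdist_ge0 | lra].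
    rewrite !Rsqr_pow2, pdist_sq.
    replace ((2 * al) ^ 2) with (4 * al ^ 2) by ring; rewrite Hal2.
    unfold v1, v2; lra.
  - intros P; rewrite Hlocus.
    rewrite (focal_sum_equation F F' P al); fold v1 v2; [|exact Hal | lra].
    rewrite Hal2.
    replace (be2 + (v1 ^ 2 + v2 ^ 2) - (v1 ^ 2 + v2 ^ 2)) with be2 by ring.
    (* The remaining side conditions are the three entries of M M^T. *)
    rewrite <- (linear_image_of_circle m11 m12 m21 m22); [| exact Hbe | | | ].
    + assert (EP : forall l1 l2,
        P = circumcenter_at a b (to_unit a b (xc, yc)) k (l1, l2) <->
        fst P - (fst F + fst F') / 2 = m11 * l1 + m12 * l2 /\
        snd P - (snd F + snd F') / 2 = m21 * l1 + m22 * l2).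
      { intros l1 l2.
        assert (E1 : fst (circumcenter_at a b (to_unit a b (xc, yc)) k (l1, l2))
          = (fst F + fst F') / 2 + (m11 * l1 + m12 * l2)).
        { unfold F, F', inner_center, outer_center, m11, m12, circumcenter_at, to_unit; simpl fst; simpl snd.
          fold X Y; unfold X; field; lra. }
        assert (E2 : snd (circumcenter_at a b (to_unit a b (xc, yc)) k (l1, l2))
          = (snd F + snd F') / 2 + (m21 * l1 + m22 * l2)).
        { unfold F, F', inner_center, outer_center, m21, m22, circumcenter_at, to_unit; simpl fst; simpl snd.
          fold X Y; unfold Y; field; lra. }
        split.
        - intros ->; rewrite E1, E2; split; ring.
        - intros [G1 G2]; apply injective_projections; [rewrite E1 | rewrite E2]; lra. }
      split; intros [l1 [l2 [Hl E]]]; exists l1, l2; (split; [exact Hl | apply EP; exact E]).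
    + apply Rminus_diag_uniq.
      transitivity ((a ^ 2 - b ^ 2) ^ 2 / (16 * a ^ 2) * cl); [|rewrite Hcl0; ring].
      rewrite Ev1; unfold m11, m12, be2, cl; field; lra.
    + apply Rminus_diag_uniq.
      transitivity ((a ^ 2 - b ^ 2) ^ 2 / (16 * b ^ 2) * cl); [|rewrite Hcl0; ring].
      rewrite Ev2; unfold m21, m22, be2, cl; field; lra.
    + rewrite Ev1, Ev2; unfold m11, m12, m21, m22; field; lra.
Qed.

(** * The two bitangent circles *)

(** The center is the midpoint of a diameter whose ends are inside the ellipse. *)
Lemma center_inside (a b r : R) (c : point) :
  0 < b -> 0 < a -> 0 < r -> circle_inside a b c r -> (fst c / a) ^ 2 + (snd c / b) ^ 2 < 1.
Proof.
  intros Hb Ha Hr Hin; destruct c as [xc yc]; simpl fst; simpl snd.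
  assert (H1 : inside_ellipse a b (xc + r, yc)).
  { apply Hin, on_circle_sq; [lra|]; simpl fst; simpl snd; ring. }
  assert (H2 : inside_ellipse a b (xc - r, yc)).
  { apply Hin, on_circle_sq; [lra|]; simpl fst; simpl snd; ring. }
  unfold inside_ellipse in H1, H2; simpl fst in *; simpl snd in *.
  assert (0 <= (r / a) ^ 2) by apply pow2_ge_0.
  replace ((xc / a) ^ 2 + (yc / b) ^ 2) with
    (((xc + r) ^ 2 / a ^ 2 + yc ^ 2 / b ^ 2 + ((xc - r) ^ 2 / a ^ 2 + yc ^ 2 / b ^ 2)) / 2
      - (r / a) ^ 2) by (field; lra).
  lra.
Qed.

Definition ellipse_defect (a b : R) (P : point) : R := 1 - (fst P / a) ^ 2 - (snd P / b) ^ 2.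

Lemma ellipse_defect_eq0 (a b : R) (P : point) :
  a <> 0 -> b <> 0 -> on_ellipse a b P <-> ellipse_defect a b P = 0.
Proof.
  intros Ha Hb; unfold on_ellipse, ellipse_defect.
  replace (fst P ^ 2 / a ^ 2 + snd P ^ 2 / b ^ 2) with ((fst P / a) ^ 2 + (snd P / b) ^ 2)
    by (field; split; assumption).
  split; intros; lra.
Qed.

(** Double contact along the line x = a X: the equation of the circle lies in the pencil
spanned by the ellipse and this line counted twice. *)
Lemma inner_equation_defect (a b X : R) (P : point) :
  a <> 0 -> b <> 0 ->
  inner_equation a b X P = (a ^ 2 - b ^ 2) * (fst P / a - X) ^ 2 - b ^ 2 * ellipse_defect a b P.
Proof. intros; unfold inner_equation, ellipse_defect; field; split; assumption. Qed.

(** Double contact along the line y = b Y; the opposite sign of the square reflects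
that this circle surrounds the ellipse. *)
Lemma outer_equation_defect (a b Y : R) (P : point) :
  a <> 0 -> b <> 0 ->
  outer_equation a b Y P = - (a ^ 2 - b ^ 2) * (snd P / b - Y) ^ 2 - a ^ 2 * ellipse_defect a b P.
Proof. intros; unfold outer_equation, ellipse_defect; field; split; assumption. Qed.

Definition inner_radius (a b X : R) : R := b * sqrt (1 - (a ^ 2 - b ^ 2) / a ^ 2 * X ^ 2).
Definition outer_radius (a b Y : R) : R := a * sqrt (1 + (a ^ 2 - b ^ 2) / b ^ 2 * Y ^ 2).

Lemma inner_radicand_gt0 (a b X : R) :
  0 < b -> b < a -> X ^ 2 < 1 -> 0 < 1 - (a ^ 2 - b ^ 2) / a ^ 2 * X ^ 2.
Proof.
  intros Hb Hab HX.
  assert (0 <= X ^ 2) by apply pow2_ge_0.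
  assert (0 < (b / a) ^ 2) by (apply pow_lt, Rdiv_lt_0_compat; lra).
  replace (1 - (a ^ 2 - b ^ 2) / a ^ 2 * X ^ 2) with (1 - X ^ 2 + (b / a) ^ 2 * X ^ 2) by (field; lra).
  assert (0 <= (b / a) ^ 2 * X ^ 2) by (apply Rmult_le_pos; lra).
  lra.
Qed.

Lemma outer_radicand_gt0 (a b Y : R) :
  0 < b -> b < a -> 0 < 1 + (a ^ 2 - b ^ 2) / b ^ 2 * Y ^ 2.
Proof.
  intros Hb Hab.
  assert (0 <= (a ^ 2 - b ^ 2) / b ^ 2 * Y ^ 2); [|lra].
  apply Rmult_le_pos; [|apply pow2_ge_0].
  apply Rlt_le, Rdiv_lt_0_compat; [nra | apply pow_lt; lra].
Qed.

Lemma inner_equation_pdist (a b xc : R) (P : point) :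
  0 < b -> b < a -> (xc / a) ^ 2 < 1 ->
  inner_equation a b (xc / a) P
    = pdist P (inner_center a b xc) ^ 2 - inner_radius a b (xc / a) ^ 2.
Proof.
  intros Hb Hab HX; rewrite pdist_sq; unfold inner_radius.
  rewrite Rpow_mult_distr, pow2_sqrt by (apply Rlt_le, inner_radicand_gt0; assumption).
  unfold inner_equation, inner_center; simpl fst; simpl snd; field; lra.
Qed.

Lemma outer_equation_pdist (a b yc : R) (P : point) :
  0 < b -> b < a ->
  outer_equation a b (yc / b) P
    = pdist P (outer_center a b yc) ^ 2 - outer_radius a b (yc / b) ^ 2.
Proof.
  intros Hb Hab; rewrite pdist_sq; unfold outer_radius.
  rewrite Rpow_mult_distr, pow2_sqrt by (apply Rlt_le, outer_radicand_gt0; assumption).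
  unfold outer_equation, outer_center; simpl fst; simpl snd; field; lra.
Qed.

Lemma on_circle_power (c P : point) (rho : R) :
  0 <= rho -> on_circle c rho P <-> pdist P c ^ 2 - rho ^ 2 = 0.
Proof.
  intros Hr; rewrite on_circle_sq, pdist_sq by exact Hr; split; intros; lra.
Qed.

Lemma two_symmetric_points (s m : R) (S : R -> R -> Prop) :
  0 < m -> (forall x y, S x y <-> x = s /\ y ^ 2 = m) ->
  (s, sqrt m) <> (s, - sqrt m) /\
  forall x y, S x y <-> (x, y) = (s, sqrt m) \/ (x, y) = (s, - sqrt m).
Proof.
  intros Hm HS; assert (Hq := sqrt_lt_R0 _ Hm); assert (Hq2 := pow2_sqrt m (Rlt_le _ _ Hm)).
  split.
  - intros E; injection E; lra.
  - intros x y; rewrite HS; split.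
    + intros [-> Hy].
      assert (Hz : (y - sqrt m) * (y + sqrt m) = 0) by (rewrite <- Hq2 in Hy; lra).
      apply Rmult_integral in Hz; destruct Hz; [left | right]; f_equal; lra.
    + intros [E | E]; injection E; intros -> ->; split; try reflexivity; [|rewrite <- Rsqr_pow2, <- Rsqr_neg, Rsqr_pow2]; exact Hq2.
Qed.

(** On the ellipse the equation of the circle reduces to the square of x - xc, so the common
points are the two points of abscissa xc, where the normal passes through the center. *)
Lemma inner_circle_bitangent (a b xc : R) :
  0 < b -> b < a -> (xc / a) ^ 2 < 1 ->
  tangent_to_ellipse_at_two_points a b (inner_center a b xc) (inner_radius a b (xc / a)).
Proof.
  intros Hb Hab HX.
  assert (Hc : 0 < a ^ 2 - b ^ 2) by nra.
  assert (Hr : 0 < inner_radius a b (xc / a)).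
  { apply Rmult_lt_0_compat; [exact Hb | apply sqrt_lt_R0, inner_radicand_gt0; assumption]. }
  assert (Hm : 0 < b ^ 2 * (1 - (xc / a) ^ 2)).
  { apply Rmult_lt_0_compat; [apply pow_lt; exact Hb | lra]. }
  destruct (two_symmetric_points xc _
    (fun x y => tangent_to_ellipse_at a b (inner_center a b xc) (inner_radius a b (xc / a)) (x, y)) Hm)
    as [Hne Hall].
  - intros x y; unfold tangent_to_ellipse_at.
    rewrite on_circle_power, <- inner_equation_pdist, inner_equation_defect, ellipse_defect_eq0 by lra.
    simpl fst; simpl snd; split.
    + intros [H1 [H2 _]]; rewrite H2 in H1.
      assert (Hx : x = xc).
      { assert (Hz : (x / a - xc / a) ^ 2 = 0).
        { apply (Rmult_eq_reg_l (a ^ 2 - b ^ 2)); lra. }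
        assert (Hw : x / a - xc / a = 0) by (apply Rsqr_0_uniq; rewrite Rsqr_pow2; exact Hz).
        replace x with (a * (x / a)) by (field; lra).
        replace (x / a) with (xc / a) by lra; field; lra. }
      split; [exact Hx|].
      unfold ellipse_defect in H2; simpl fst in H2; simpl snd in H2; rewrite Hx in H2.
      transitivity (b ^ 2 * (y / b) ^ 2); [field; lra | f_equal; lra].
    + intros [-> Hy].
      assert (Hd : ellipse_defect a b (xc, y) = 0).
      { unfold ellipse_defect; simpl fst; simpl snd.
        replace ((y / b) ^ 2) with (y ^ 2 / b ^ 2) by (field; lra); rewrite Hy; field; lra. }
      rewrite Hd; split; [ring | split; [reflexivity|]].
      unfold inner_center; field; lra.
  - exists (xc, sqrt (b ^ 2 * (1 - (xc / a) ^ 2))), (xc, - sqrt (b ^ 2 * (1 - (xc / a) ^ 2))).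
    split; [exact Hne|]; intros [x y]; apply Hall.
Qed.

(** Same argument as for the inner circle, with the ordinate yc. *)
Lemma outer_circle_bitangent (a b yc : R) :
  0 < b -> b < a -> (yc / b) ^ 2 < 1 ->
  tangent_to_ellipse_at_two_points a b (outer_center a b yc) (outer_radius a b (yc / b)).
Proof.
  intros Hb Hab HY.
  assert (Hc : 0 < a ^ 2 - b ^ 2) by nra.
  assert (Hr : 0 < outer_radius a b (yc / b)).
  { apply Rmult_lt_0_compat; [lra | apply sqrt_lt_R0, outer_radicand_gt0; assumption]. }
  assert (Hm : 0 < a ^ 2 * (1 - (yc / b) ^ 2)).
  { apply Rmult_lt_0_compat; [apply pow_lt; lra | lra]. }
  destruct (two_symmetric_points yc _
    (fun y x => tangent_to_ellipse_at a b (outer_center a b yc) (outer_radius a b (yc / b)) (x, y)) Hm)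
    as [Hne Hall].
  - intros y x; unfold tangent_to_ellipse_at.
    rewrite on_circle_power, <- outer_equation_pdist, outer_equation_defect, ellipse_defect_eq0 by lra.
    simpl fst; simpl snd; split.
    + intros [H1 [H2 _]]; rewrite H2 in H1.
      assert (Hy : y = yc).
      { assert (Hz : (y / b - yc / b) ^ 2 = 0).
        { apply (Rmult_eq_reg_l (a ^ 2 - b ^ 2)); lra. }
        assert (Hw : y / b - yc / b = 0) by (apply Rsqr_0_uniq; rewrite Rsqr_pow2; exact Hz).
        replace y with (b * (y / b)) by (field; lra).
        replace (y / b) with (yc / b) by lra; field; lra. }
      split; [exact Hy|].
      unfold ellipse_defect in H2; simpl fst in H2; simpl snd in H2; rewrite Hy in H2.
      transitivity (a ^ 2 * (x / a) ^ 2); [field; lra | f_equal; lra].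
    + intros [-> Hx].
      assert (Hd : ellipse_defect a b (x, yc) = 0).
      { unfold ellipse_defect; simpl fst; simpl snd.
        replace ((x / a) ^ 2) with (x ^ 2 / a ^ 2) by (field; lra); rewrite Hx; field; lra. }
      rewrite Hd; split; [ring | split; [reflexivity|]].
      unfold outer_center; field; lra.
  - exists (sqrt (a ^ 2 * (1 - (yc / b) ^ 2)), yc), (- sqrt (a ^ 2 * (1 - (yc / b) ^ 2)), yc).
    assert (Hswap : forall x y x' y' : R, (y, x) = (y', x') <-> (x, y) = (x', y')).
    { intros; split; intros E; injection E; intros -> ->; reflexivity. }
    split; [intros E; apply Hne, Hswap, E|].
    intros [x y]; rewrite <- !(Hswap x y); apply Hall.
Qed.

(** The closed inner disc lies inside the ellipse and the ellipse inside the closed outer disc;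
a point where neither inclusion is strict would be (xc, yc) on the ellipse, but (xc, yc) is
strictly inside. *)
Lemma bitangent_circles_nested (a b xc yc : R) :
  0 < b -> b < a -> (xc / a) ^ 2 + (yc / b) ^ 2 < 1 ->
  nested_circles (inner_center a b xc) (inner_radius a b (xc / a))
    (outer_center a b yc) (outer_radius a b (yc / b)).
Proof.
  intros Hb Hab Hw; left; intros P HP; unfold inside_circle.
  assert (0 <= (xc / a) ^ 2) by apply pow2_ge_0; assert (0 <= (yc / b) ^ 2) by apply pow2_ge_0.
  assert (Hc : 0 < a ^ 2 - b ^ 2) by nra.
  assert (Ho : 0 <= outer_radius a b (yc / b)).
  { apply Rmult_le_pos; [lra | apply sqrt_pos]. }
  apply Rsqr_incrst_0; [|apply pdist_ge0 | exact Ho]; rewrite !Rsqr_pow2.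
  assert (Hi : inner_equation a b (xc / a) P <= 0).
  { rewrite inner_equation_pdist by lra.
    assert (pdist P (inner_center a b xc) ^ 2 <= inner_radius a b (xc / a) ^ 2)
      by (apply pow_incr; split; [apply pdist_ge0 | exact HP]).
    lra. }
  assert (E := outer_equation_pdist a b yc P Hb Hab).
  rewrite outer_equation_defect in E by lra; rewrite inner_equation_defect in Hi by lra.
  assert (Hd : ellipse_defect a b P = 1 - (fst P / a) ^ 2 - (snd P / b) ^ 2) by reflexivity.
  set (d := ellipse_defect a b P) in *; set (x := fst P / a) in *; set (y := snd P / b) in *.
  set (X := xc / a) in *; set (Y := yc / b) in *.
  assert (Hx : 0 <= (a ^ 2 - b ^ 2) * (x - X) ^ 2) by (apply Rmult_le_pos; [lra | apply pow2_ge_0]).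
  assert (Hy : 0 <= (a ^ 2 - b ^ 2) * (y - Y) ^ 2) by (apply Rmult_le_pos; [lra | apply pow2_ge_0]).
  assert (Hb2 : 0 < b ^ 2) by (apply pow_lt; lra); assert (Ha2 : 0 < a ^ 2) by (apply pow_lt; lra).
  assert (Hd0 : 0 <= d) by (apply (Rmult_le_reg_l (b ^ 2)); lra).
  assert (Had : 0 <= a ^ 2 * d) by (apply Rmult_le_pos; lra).
  destruct (Req_dec d 0) as [Hz|Hz].
  - assert (Hyn : y - Y <> 0).
    { intros F; rewrite Hz in Hi.
      assert (G : (x - X) ^ 2 = 0).
      { apply (Rmult_eq_reg_l (a ^ 2 - b ^ 2)); lra. }
      assert (x - X = 0) by (apply Rsqr_0_uniq; rewrite Rsqr_pow2; exact G).
      replace X with x in Hw by lra; replace Y with y in Hw by lra; lra. }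
    assert (0 < (y - Y) ^ 2) by (rewrite <- Rsqr_pow2; apply Rsqr_pos_lt; exact Hyn).
    assert (0 < (a ^ 2 - b ^ 2) * (y - Y) ^ 2) by (apply Rmult_lt_0_compat; assumption).
    lra.
  - assert (0 < a ^ 2 * d) by (apply Rmult_lt_0_compat; lra).
    lra.
Qed.

(** * The envelope *)

(** K = 0 and dK/du = 0 say that the affine function A + B Re l + E Im l vanishes at l(u) and is
stationary there along the unit circle.  Conversely such an l is reached by the
parametrization, because every l occurs in the family and l depends only on the
unlabelled triangle. *)
Lemma envelope_discriminant (a b r : R) (c : point)
    (T : R -> plane_triangle) (o : R -> point) (rho : R -> R) (P : point) :
  0 < b -> b < a -> 0 < r -> circle_inside a b c r ->
  closure_relation (to_unit a b c) (focal_par a b r) (axes_par a b r) ->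
  regular_parametrization (poncelet_triangle a b c r) T ->
  (forall u, is_circumcircle (T u) (o u) (rho u)) ->
  envelope (circle_eqn o rho) P <->
  circle_const a b (to_unit a b c) (focal_par a b r) P ^ 2
    = circle_cos a b (to_unit a b c) (focal_par a b r) P ^ 2
      + circle_sin a b (to_unit a b c) (focal_par a b r) P ^ 2.
Proof.
  intros Hb Hab Hr Hin Hcl [HF [Hsurj [RA [RB RC]]]] Hcirc.
  assert (Ha : 0 < a) by lra.
  assert (Hrel : forall x, poncelet_relations a b c r (T x))
    by (intros x; apply poncelet_triangle_relations; auto).
  set (l := fun x => vertex_product a b (T x)).
  assert (Ul : forall x, on_unit_circle (l x))
    by (intros x; destruct (Hrel x); repeat apply on_unit_circle_mult; assumption).
  set (A := circle_const a b (to_unit a b c) (focal_par a b r) P).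
  set (B := circle_cos a b (to_unit a b c) (focal_par a b r) P).
  set (E := circle_sin a b (to_unit a b c) (focal_par a b r) P).
  assert (HK : forall x, circle_eqn o rho P x = A + B * fst (l x) + E * snd (l x)).
  { intros x; destruct (poncelet_circumcircle _ _ _ _ _ _ _ Hb Hab (Hrel x) (Hcirc x)) as [Ho Hp].
    unfold A, B, E; rewrite <- circle_family_affine by lra.
    unfold l; rewrite <- Ho, <- Hp; unfold circle_eqn; ring. }
  assert (HD : forall x v, is_cderive l x v ->
    is_derive (fun w => circle_eqn o rho P w) x (B * fst v + E * snd v)).
  { intros x v [D1 D2].
    apply (is_derive_ext (fun w => A + B * fst (l w) + E * snd (l w)));
      [intros w; symmetry; apply HK|].
    apply (is_derive_affine (fun w => fst (l w)) (fun w => snd (l w))); assumption. }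
  assert (Ht : forall x v, is_cderive l x v -> fst (l x) * fst v + snd (l x) * snd v = 0).
  { intros x v D; apply unit_curve_orthogonal; assumption. }
  split.
  - intros [u [H0 H1]].
    destruct (vertex_product_velocity a b r c T u Hb Ha Hrel RA RB RC) as [v [Dv Nv]].
    apply (stationary_on_circle A B E (fst (l u)) (snd (l u)) (fst v) (snd v)).
    + apply on_unit_circle_coord, Ul.
    + apply Ht, Dv.
    + intros F; apply Nv; destruct v; exact F.
    + rewrite <- HK; exact H0.
    + rewrite <- (is_derive_unique _ _ _ (HD u v Dv)); apply is_derive_unique, H1.
  - intros H; destruct (stationary_parameter_exists A B E H) as [l1 [l2 [Hl [H0 H1]]]].
    destruct (poncelet_triangle_exists a b r c (l1, l2) Hb Ha Hr Hin Hcl) as [t [Ht' Hprod]].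
    { apply on_unit_circle_coord; exact Hl. }
    destruct (Hsurj t Ht') as [u Hu].
    assert (Elu : l u = (l1, l2)).
    { rewrite <- Hprod; apply (same_triangle_vertex_product a b r c); try assumption.
      - apply Hrel.
      - apply poncelet_triangle_relations; assumption. }
    exists u; split.
    + rewrite HK, Elu; exact H0.
    + destruct (vertex_product_velocity a b r c T u Hb Ha Hrel RA RB RC) as [v [Dv _]].
      assert (Htv := Ht u v Dv); rewrite Elu in Htv; simpl fst in Htv; simpl snd in Htv.
      replace 0 with (B * fst v + E * snd v); [apply HD, Dv|].
      transitivity ((l1 * l1 + l2 * l2) * (B * fst v + E * snd v)); [rewrite Hl; ring|].
      transitivity ((B * l1 + E * l2) * (l1 * fst v + l2 * snd v)
        + (E * l1 - B * l2) * (l1 * snd v - l2 * fst v)); [ring | rewrite Htv, H1; ring].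
Qed.

Theorem proposition5 :
  forall (a b : R) (xc yc r : R),
    0 < b -> b < a -> 0 < r ->
    (forall P, on_circle (xc, yc) r P -> inside_ellipse a b P) ->
    (exists t, poncelet_triangle a b (xc, yc) r t) ->
    let F3 : point := (xc * (1 - (b / a)^2), 0) in
    let F3' : point := (0, yc * (1 - (a / b)^2)) in
    conic_with_foci (circumcenter_locus (poncelet_triangle a b (xc, yc) r)) F3 F3' /\
    exists r1 r2 : R, 0 < r1 /\ 0 < r2 /\
      (forall (T : R -> plane_triangle) (o : R -> point) (rho : R -> R),
         regular_parametrization (poncelet_triangle a b (xc, yc) r) T ->
         (forall u, is_circumcircle (T u) (o u) (rho u)) ->
         forall P, envelope (circle_eqn o rho) P <->
                   on_circle F3 r1 P \/ on_circle F3' r2 P) /\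
      nested_circles F3 r1 F3' r2 /\
      tangent_to_ellipse_at_two_points a b F3 r1 /\
      tangent_to_ellipse_at_two_points a b F3' r2.
Proof.
  intros a b xc yc r Hb Hab Hr Hin [t Ht] F3 F3'.
  assert (Ha : 0 < a) by lra.
  assert (Hcl := proj2 (poncelet_vertex_sum _ _ _ _ _
    (poncelet_triangle_relations a b r (xc, yc) t Hb Ha Hr Ht))).
  assert (Hw := center_inside a b r (xc, yc) Hb Ha Hr Hin); simpl fst in Hw; simpl snd in Hw.
  assert (0 <= (xc / a) ^ 2) by apply pow2_ge_0; assert (0 <= (yc / b) ^ 2) by apply pow2_ge_0.
  assert (HX : (xc / a) ^ 2 < 1) by lra; assert (HY : (yc / b) ^ 2 < 1) by lra.
  assert (R1 : 0 < inner_radius a b (xc / a)).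
  { apply Rmult_lt_0_compat; [exact Hb | apply sqrt_lt_R0, inner_radicand_gt0; assumption]. }
  assert (R2 : 0 < outer_radius a b (yc / b)).
  { apply Rmult_lt_0_compat; [exact Ha | apply sqrt_lt_R0, outer_radicand_gt0; assumption]. }
  split; [apply circumcenter_locus_conic; assumption|].
  exists (inner_radius a b (xc / a)), (outer_radius a b (yc / b)).
  split; [exact R1|]; split; [exact R2|]; split; [|split; [|split]].
  - intros T o rho HT Hcirc P.
    rewrite (envelope_discriminant a b r (xc, yc) T o rho P Hb Hab Hr Hin Hcl HT Hcirc).
    rewrite !on_circle_power by lra.
    rewrite <- (inner_equation_pdist a b xc) by assumption.
    rewrite <- (outer_equation_pdist a b yc) by assumption.
    assert (Hf := discriminant_factors a b r (to_unit a b (xc, yc)) P (Rgt_not_eq _ _ Ha)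
      (Rgt_not_eq _ _ Hb) Hcl).
    change (fst (to_unit a b (xc, yc))) with (xc / a) in Hf.
    change (snd (to_unit a b (xc, yc))) with (yc / b) in Hf.
    split.
    + intros H'; apply Rmult_integral; rewrite <- Hf, H'; ring.
    + intros H'; apply Rminus_diag_uniq; rewrite Hf.
      destruct H' as [-> | ->]; ring.
  - apply bitangent_circles_nested; assumption.
  - apply inner_circle_bitangent; assumption.
  - apply outer_circle_bitangent; assumption.
Qed.
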